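(* Let $(\mathscr{A},\psi)$ be a semi-finite, $\sigma$-finite tracial von Neumann algebra. (i) Let $M\subseteq N$ be right-$\mathscr{A}$-modules. Suppose that for every $x\in N$ there is a sequence $(p_n)$ of projections in $\mathscr{A}$ such that $p_n\nearrow 1$ and $x.p_n\in M$ for all $n$. Then $\dim_\psi N/M=0$ and $\dim_\psi M=\dim_\psi N$. (ii) Let $M$ be a right-$\mathscr{A}$-module with $\dim_\psi M=0$. Then for every $x\in M$ there is a sequence $(p_n)$ of projections in $\mathscr{A}$ such that $p_n\nearrow 1$ and $x.p_n=0$ for all $n\in\mathbb{N}$.
   Context: A semi-finite tracial von Neumann algebra $(\mathscr{A},\psi)$ is a von Neumann algebra with a faithful, normal, semi-finite tracial weight $\psi$; it is $\sigma$-finite if every family of pairwise orthogonal nonzero projections is countable. Modules are purely algebraic. The $\psi$-dimension of a right-$\mathscr{A}$-module $M$ is the supremum in $[0,\infty]$ of $(\mathrm{Tr}_n\otimes\psi)(p)$ over all $n\in\mathbb{N}$ and all projections $p\in M_n(\mathscr{A})$ with $(\mathrm{Tr}_n\otimes\psi)(p)<\infty$ such that $p\mathscr{A}^n$ is isomorphic to a submodule of $M$. $p_n\nearrow 1$ means that $(p_n)$ is increasing with supremum the identity. *)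

(* Defs.v *)
From HB Require Import structures.
From mathcomp Require Import all_boot all_order all_algebra.
From mathcomp Require Import sesquilinear generic_quotient ring_quotient.
From mathcomp Require Import complex.
From mathcomp Require Import all_classical all_reals all_analysis.

Set Implicit Arguments.
Unset Strict Implicit.
Unset Printing Implicit Defensive.
Import Order.TTheory GRing.Theory Num.Theory.
Import numFieldNormedType.Exports.

Local Open Scope classical_set_scope.
Local Open Scope complex_scope.
Local Open Scope ring_scope.

(* Complex Hilbert spaces; the inner product is linear in its first variable. *)
HB.mixin Record CompleteNormedModule_isHilbert (R : realType) H
    & CompleteNormedModule R[i] H := {
  hdot : {dot H for @Num.conj R[i]} ;
  hdot_norm : forall x : H, hdot x x = `|x| ^+ 2 }.

#[short(type="hilbertType")]
HB.structure Definition Hilbert (R : realType) :=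
  {H of CompleteNormedModule_isHilbert R H & CompleteNormedModule R[i] H}.

Section VonNeumannAlgebras.
Variables (R : realType) (H : hilbertType R).
Implicit Types (S T U : H -> H).

Definition bounded_op T : Prop := linear T /\ continuous T.

Definition adjoint_op T S : Prop := forall x y : H, hdot (T x) y = hdot x (S y).

Definition commutant (X : set (H -> H)) : set (H -> H) :=
  [set T | bounded_op T /\ forall U, X U -> T \o U = U \o T].

(* Being a unital subalgebra of B(H) is a consequence of [vn_bicommutant]; see
   the instances below. *)
Record vnAlgebra := VnAlgebra {
  vn_ops : set (H -> H) ;
  vn_adjoint : forall T, vn_ops T -> exists2 S, vn_ops S & adjoint_op T S ;
  vn_bicommutant : commutant (commutant vn_ops) = vn_ops }.

Definition vn_sort (A : vnAlgebra) : Type := set_type (vn_ops A).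

End VonNeumannAlgebras.

Coercion vn_sort : vnAlgebra >-> Sortclass.

Section RingStructure.
Variables (R : realType) (H : hilbertType R) (A : vnAlgebra H).
Implicit Types (S T U : H -> H).

Lemma commutant_linear (X : set (H -> H)) T :
  commutant X T -> linear T.
Proof. by case=> -[]. Qed.

Lemma commutant_id (X : set (H -> H)) : commutant X id.
Proof. by split; [split=> // x|]. Qed.

Lemma commutant_comp (X : set (H -> H)) S T :
  commutant X S -> commutant X T -> commutant X (S \o T).
Proof.
move=> [[lS cS] XS] [[lT cT] XT]; split.
  split=> [a x y|x]; first by rewrite /= lT lS.
  exact: (continuous_comp (cT x) (cS (T x))).
by move=> U XU; rewrite -compA XT// compA XS.
Qed.

Lemma commutant_lincomb (X : set (H -> H)) (c : R[i]) S T :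
  (forall U, X U -> linear U) ->
  commutant X S -> commutant X T -> commutant X (c *: S + T).
Proof.
move=> lX [[lS cS] XS] [[lT cT] XT].
have E z : (c *: S + T) z = c *: S z + T z by [].
split.
  split=> [a x y|x].
    by rewrite !E lT lS !scalerDr !scalerA mulrC addrACA.
  apply: (@continuousD _ _ _ (c *: S) T x); last exact: cT.
  exact: (@continuousZr _ _ _ S c x (cS x)).
move=> U XU; apply/funext => x /=; rewrite !E (lX U XU).
have /(congr1 (@^~ x)) /= -> := XS U XU.
by have /(congr1 (@^~ x)) /= -> := XT U XU.
Qed.

Let vn_commutant T : vn_ops A T <-> commutant (commutant (vn_ops A)) T.
Proof. by rewrite vn_bicommutant. Qed.

Lemma vn_bounded T : vn_ops A T -> bounded_op T.
Proof. by rewrite vn_commutant => -[]. Qed.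

Lemma vn_id : vn_ops A id.
Proof. by rewrite vn_commutant; exact: commutant_id. Qed.

Lemma vn_comp S T : vn_ops A S -> vn_ops A T -> vn_ops A (S \o T).
Proof. by rewrite !vn_commutant; exact: commutant_comp. Qed.

Lemma vn_lincomb (c : R[i]) S T :
  vn_ops A S -> vn_ops A T -> vn_ops A (c *: S + T).
Proof.
rewrite !vn_commutant; apply: commutant_lincomb => U; exact: commutant_linear.
Qed.

Definition vn_pred : {pred H -> H} := fun T => T \in vn_ops A.

Fact vn_submod_closed : submod_closed vn_pred.
Proof.
split=> [|c S T]; rewrite !unfold_in /=.
  apply/mem_set; have := vn_lincomb (-1) vn_id vn_id.
  by rewrite scaleN1r addNr.
by move=> /set_mem AS /set_mem AT; apply/mem_set; exact: vn_lincomb.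
Qed.

HB.instance Definition _ :=
  GRing.isSubmodClosed.Build R[i] (H -> H) vn_pred vn_submod_closed.

HB.instance Definition _ := SubChoice.copy (vn_sort A) {T : H -> H | vn_pred T}.
HB.instance Definition _ := [SubChoice_isSubLmodule of vn_sort A by <:].

Definition vn_one : A := exist _ id (mem_set vn_id).
Definition vn_mul (a b : A) : A :=
  exist _ (val a \o val b) (mem_set (vn_comp (set_mem (valP a)) (set_mem (valP b)))).

Fact vn_mulA : associative vn_mul.
Proof. by move=> a b c; apply/val_inj. Qed.
Fact vn_mul1l : left_id vn_one vn_mul.
Proof. by move=> a; apply/val_inj. Qed.
Fact vn_mul1r : right_id vn_one vn_mul.
Proof. by move=> a; apply/val_inj. Qed.
Fact vn_mulDl : left_distributive vn_mul +%R.
Proof. by move=> a b c; apply/val_inj. Qed.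
Fact vn_mulDr : right_distributive vn_mul +%R.
Proof.
move=> a b c; apply/val_inj/funext => x /=.
have [la _] := vn_bounded (set_mem (valP a)).
by have := la 1 (val b x) (val c x); rewrite !scale1r.
Qed.

HB.instance Definition _ := GRing.Zmodule_isPzRing.Build (vn_sort A)
  vn_mulA vn_mul1l vn_mul1r vn_mulDl vn_mulDr.

Fact star_exists (a : A) : exists b : A, adjoint_op (val a) (val b).
Proof.
have [S AS aS] := vn_adjoint (set_mem (valP a)).
by exists (exist _ S (mem_set AS)).
Qed.

Definition star (a : A) : A := projT1 (cid (star_exists a)).

Lemma starP (a : A) : adjoint_op (val a) (val (star a)).
Proof. exact: projT2 (cid (star_exists a)). Qed.

End RingStructure.

Section Traces.
Variables (R : realType) (H : hilbertType R) (A : vnAlgebra H).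
Implicit Types (a b : A) (D : set A).

(* In the order of R[i], [0 <= z] means that z is a nonnegative real. *)
Definition vn_pos a : Prop := forall x : H, 0 <= hdot (val a x) x.
Definition vn_le a b : Prop := vn_pos (b - a).

(* An upper bound of self-adjoint elements is self-adjoint, so this is the
   supremum in the self-adjoint part of A. *)
Definition vn_is_sup D a : Prop :=
  (forall b, D b -> vn_le b a) /\
  (forall c, (forall b, D b -> vn_le b c) -> vn_le a c).

Definition vn_directed D : Prop :=
  D !=set0 /\
  forall a b, D a -> D b -> exists c, [/\ D c, vn_le a c & vn_le b c].

Definition is_proj a : Prop := a * a = a /\ star a = a.

Definition increases_to_1 (p : nat -> A) : Prop :=
  (forall n, vn_le (p n) (p n.+1)) /\ vn_is_sup (range p) 1.

Definition sigma_finite_vn : Prop := forall D,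
  (forall a, D a -> is_proj a /\ a <> 0) ->
  (forall a b, D a -> D b -> a <> b -> a * b = 0) ->
  countable D.

(* A weight is a function on the positive cone: psi is unconstrained elsewhere. *)
Record tracial_weight (psi : A -> \bar R) : Prop := TracialWeight {
  tw_ge0 : forall a, vn_pos a -> (0 <= psi a)%E ;
  tw_add : forall a b, vn_pos a -> vn_pos b -> psi (a + b) = (psi a + psi b)%E ;
  tw_scale : forall (t : R) a, 0 <= t -> vn_pos a ->
    psi (t%:C *: a) = (t%:E * psi a)%E ;
  tw_trace : forall a, psi (star a * a) = psi (a * star a) }.

Definition faithful_weight (psi : A -> \bar R) : Prop :=
  forall a, vn_pos a -> psi a = 0%E -> a = 0.

Definition normal_weight (psi : A -> \bar R) : Prop :=
  forall D a, (forall b, D b -> vn_pos b) -> vn_directed D -> vn_is_sup D a ->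
    psi a = ereal_sup (psi @` D).

Definition semifinite_weight (psi : A -> \bar R) : Prop :=
  forall a, vn_pos a -> a <> 0 ->
    exists b, [/\ vn_pos b, b <> 0, vn_le b a & (psi b < +oo)%E].

Record semifinite_tracial (psi : A -> \bar R) : Prop := SemifiniteTracial {
  st_tracial : tracial_weight psi ;
  st_faithful : faithful_weight psi ;
  st_normal : normal_weight psi ;
  st_semifinite : semifinite_weight psi }.

Definition is_mxproj n (p : 'M[A]_n) : Prop :=
  p *m p = p /\ (map_mx (@star R H A) p)^T = p.

(* The value of Tr_n (x) psi at p. *)
Definition mxtrace_weight (psi : A -> \bar R) n (p : 'M[A]_n) : \bar R :=
  (\sum_(i < n) psi (p i i))%E.

End Traces.

Section SubmodulesAndQuotients.
Variables (S : pzRingType) (N : lmodType S) (M : submodClosed N).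

Definition submodule : Type := {x : N | x \in M}.
HB.instance Definition _ := SubChoice.on submodule.
HB.instance Definition _ := [SubChoice_isSubLmodule of submodule by <:].

(* [submodClosed N] does not inherit from [zmodClosed N] in the library. *)
Definition submod_zmod : {pred N} := fun x => x \in M.
HB.instance Definition _ := GRing.isZmodClosed.Build N submod_zmod
  (GRing.submod_closedB (submodClosedP M)).

Definition quotmod : Type := Quotient.quot submod_zmod.
HB.instance Definition _ := GRing.Zmodule.on quotmod.

Definition pi_quotmod (x : N) : quotmod := \pi_(Quotient.quot submod_zmod)%qT x.
Local Notation pi := pi_quotmod.

Lemma pi_quotmod_eq x y : pi x = pi y <-> x - y \in M.
Proof.
rewrite -[_ \in M]/(x - y \in submod_zmod) Quotient.idealrBE.
by split=> [e|/eqP]//; apply/eqP.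
Qed.

Definition quot_scale (a : S) (q : quotmod) : quotmod :=
  pi (a *: (repr (q : Quotient.quot submod_zmod))).

Fact quot_scale_pi a x : quot_scale a (pi x) = pi (a *: x).
Proof.
apply/pi_quotmod_eq; rewrite -scalerBr rpredZ//; apply/pi_quotmod_eq.
by rewrite /pi_quotmod reprK.
Qed.

Let piD x y : pi (x + y) = pi x + pi y.
Proof. exact: raddfD. Qed.

Let pi_surj (q : quotmod) : exists x, q = pi x.
Proof. by exists (repr (q : Quotient.quot submod_zmod)); rewrite /pi_quotmod reprK. Qed.

Fact quot_scaleA a b q : quot_scale a (quot_scale b q) = quot_scale (a * b) q.
Proof. by have [x ->] := pi_surj q; rewrite !quot_scale_pi scalerA. Qed.
Fact quot_scale1 : left_id 1 quot_scale.
Proof. by move=> q; have [x ->] := pi_surj q; rewrite quot_scale_pi scale1r. Qed.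
Fact quot_scaleDr : right_distributive quot_scale +%R.
Proof.
move=> a q r; have [x ->] := pi_surj q; have [y ->] := pi_surj r.
by rewrite -piD !quot_scale_pi scalerDr piD.
Qed.
Fact quot_scaleDl q : {morph quot_scale^~ q : a b / a + b}.
Proof.
by move=> a b; have [x ->] := pi_surj q; rewrite !quot_scale_pi scalerDl piD.
Qed.

HB.instance Definition _ := GRing.Zmodule_isLmodule.Build S quotmod
  quot_scaleA quot_scale1 quot_scaleDr quot_scaleDl.

End SubmodulesAndQuotients.

(* Right A-modules are left modules over the converse ring A^c. *)
Notation rightModType A := (lmodType (vn_sort A)^c).

Section Dimension.
Variables (R : realType) (H : hilbertType R) (A : vnAlgebra H).

Definition ract (M : rightModType A) (x : M) (a : A) : M := (a : (vn_sort A)^c) *: x.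

(* The right A-module A^n is 'cV[A^c]_n, with a acting by v_i |-> v_i * a;
   matrices in M_n(A) act on it from the left, the product of their entries
   being taken in A. *)
Section ProjectiveModule.
Variables (n : nat) (p : 'M[A]_n).

Definition mx_image : {pred 'cV[(vn_sort A)^c]_n} :=
  fun v => `[< exists w : 'cV[A]_n, v = p *m w >].

Fact mx_image_submod_closed : submod_closed mx_image.
Proof.
split=> [|a u v]; rewrite !unfold_in.
  by apply/asboolP; exists 0; rewrite mulmx0.
move=> /asboolP[u' ->] /asboolP[v' ->]; apply/asboolP.
exists (a *: (u' : 'cV[(vn_sort A)^c]_n) + (v' : 'cV[(vn_sort A)^c]_n)).
apply/matrixP => i j; rewrite !mxE [RHS](_ : _ =
  \sum_k (p i k * u' k j * a + p i k * v' k j)); last first.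
  by apply: eq_bigr => k _; rewrite !mxE mulrDr mulrA.
by rewrite big_split -mulr_suml.
Qed.

HB.instance Definition _ := GRing.isSubmodClosed.Build
  (vn_sort A)^c 'cV[(vn_sort A)^c]_n mx_image mx_image_submod_closed.

End ProjectiveModule.

Definition iso_to_submodule (P M : rightModType A) : Prop :=
  exists (L : submodClosed M) (f : {linear P -> submodule L}), bijective f.

Definition vn_dim (psi : A -> \bar R) (M : rightModType A) : \bar R :=
  ereal_sup [set d | exists n (p : 'M[A]_n),
    [/\ is_mxproj p,
        (mxtrace_weight psi p < +oo)%E,
        iso_to_submodule (submodule (mx_image p)) M &
        d = mxtrace_weight psi p]].

End Dimension.

(* Main.v *)
Require Import Defs.
From HB Require Import structures.
From mathcomp Require Import all_boot all_order all_algebra.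
From mathcomp Require Import complex.
From mathcomp Require Import all_classical all_reals all_analysis.
From mathcomp Require Import ring lra.

Set Implicit Arguments.
Unset Strict Implicit.
Unset Printing Implicit Defensive.
Import Order.TTheory GRing.Theory Num.Theory.
Import numFieldNormedType.Exports.

Local Open Scope complex_scope.
Local Open Scope ring_scope.

(* (i) If p A^n embeds in N / M, the generators p e_i are killed by sequences
   increasing to 1, hence vanish. If p A^n embeds in N by f, let Q be the
   diagonal matrix of the q_i with f(p e_i) q_i in M, and let r <= p be the
   support of Q p. Then x |-> f (p Q p x) is injective on r A^n with values in M,
   and Tr r >= Tr (p Q p), which tends to Tr p by normality when the q_i increase
   to 1.
   (ii) If dim M = 0, then below every nonzero projection e lies one of finite
   trace, q, and y |-> x y is not injective on q A; it kills some a <> 0, hence a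
   spectral projection of a a*. By Zorn's lemma a maximal orthogonal family of
   projections killed by x has sum 1, and it is countable. *)

(** * Orthogonal projections *)

(** [A] is given only as its own bicommutant, so supports, absolute values and inverses are built as
    operators on H or H^n and enter [A] by commuting with the commutant. The order condition on p_n
    is awkward for normality: a supremum is not visibly preserved by a -> c* a c when c is not
    invertible. It is traded for triviality of the common kernel, then for strong convergence, which
    conjugation respects. In (i), r is the right support of Q p, which puts it below p: Tr r is
    finite, and Q p = Q r gives p Q p = r Q r <= r, so the trace inequality is mere positivity. The
    values of Q p leave p A^n, the domain of f; a further factor p brings them back, and it loses
    nothing because y = Q p x satisfies y* y = x* (p Q p x). In (ii), the dimension tests only
    projections of finite trace, so semi-finiteness must first supply one below e. *)

(* A complex Hilbert space is handled through the real inner product Re <x, y>,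
   which also covers H^n without building a norm on it. *)
Record is_real_hilbert (R : realType) (V : lmodType R[i]) (rd : V -> V -> R) :
    Prop := IsRealHilbert {
  rdDl : forall x y z, rd (x + y) z = rd x z + rd y z ;
  rdZl : forall (t : R) x y, rd (t%:C *: x) y = t * rd x y ;
  rdC : forall x y, rd x y = rd y x ;
  rd_ge0 : forall x, 0 <= rd x x ;
  rd_eq0 : forall x, rd x x = 0 -> x = 0 ;
  rd_complete : forall u : nat -> V,
    (forall e : R, 0 < e -> exists N, forall m n, (N <= m)%N -> (N <= n)%N ->
       rd (u m - u n) (u m - u n) <= e) ->
    exists l, forall e : R, 0 < e -> exists N, forall n, (N <= n)%N ->
       rd (u n - l) (u n - l) <= e }.

Section RealHilbert.
Variables (R : realType) (V : lmodType R[i]) (rd : V -> V -> R).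
Hypothesis rdH : is_real_hilbert rd.
Implicit Types (x y z : V) (t : R) (S : V -> Prop).

Let Dl := rdDl rdH.
Let Zl := rdZl rdH.
Let C := rdC rdH.
Let ge0 := rd_ge0 rdH.

Lemma rdDr x y z : rd x (y + z) = rd x y + rd x z.
Proof. by rewrite C Dl !(C x). Qed.

Lemma rdZr t x y : rd x (t%:C *: y) = t * rd x y.
Proof. by rewrite C Zl C. Qed.

Lemma rdNl x y : rd (- x) y = - rd x y.
Proof.
apply/eqP; rewrite -addr_eq0 -Dl addNr -[0](scale0r 0).
by rewrite -[0 in X in X *: _](rmorph0 (real_complex R)) Zl mul0r.
Qed.

Lemma rdNr x y : rd x (- y) = - rd x y.
Proof. by rewrite C rdNl C. Qed.

Lemma rd0l x : rd 0 x = 0.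
Proof. by have := Dl 0 0 x; rewrite addr0 => h; lra. Qed.

Lemma rd0r x : rd x 0 = 0.
Proof. by rewrite C rd0l. Qed.

Definition rnorm x := Num.sqrt (rd x x).

Lemma rnorm_ge0 x : 0 <= rnorm x.
Proof. exact: sqrtr_ge0. Qed.

Lemma rnorm_sqr x : rnorm x ^+ 2 = rd x x.
Proof. by rewrite sqr_sqrtr. Qed.

Lemma rnorm_eq0 x : rnorm x = 0 -> x = 0.
Proof. by move=> h; apply: (rd_eq0 rdH); rewrite -rnorm_sqr h expr0n. Qed.

Lemma rd_CauchySchwarz x y : `|rd x y| <= rnorm x * rnorm y.
Proof.
have h : rd x y ^+ 2 <= rd x x * rd y y.
  have [y0|y0] := eqVneq (rd y y) 0.
    by rewrite (rd_eq0 rdH y0) rd0r rd0l expr0n mulr0.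
  have yp : 0 < rd y y by rewrite lt_def y0 ge0.
  have := mulr_ge0 (ltW yp) (ge0 (x - ((rd x y / rd y y)%:C *: y))).
  rewrite Dl !rdDr !rdNl !rdNr !Zl !rdZr (C y x).
  rewrite [X in 0 <= X -> _](_ : _ = rd x x * rd y y - rd x y ^+ 2).
    by rewrite subr_ge0.
  by field.
rewrite -(@ler_pXn2r _ 2) ?nnegrE ?mulr_ge0 ?sqrtr_ge0 //.
by rewrite -normrX ger0_norm ?sqr_ge0 // exprMn !rnorm_sqr.
Qed.

Lemma rnormD x y : rnorm (x + y) <= rnorm x + rnorm y.
Proof.
rewrite -(@ler_pXn2r _ 2) ?nnegrE ?addr_ge0 ?sqrtr_ge0 //.
rewrite rnorm_sqr Dl !rdDr (C y x) sqrrD !rnorm_sqr.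
have := rd_CauchySchwarz x y; have := ler_norm (rd x y); lra.
Qed.

Lemma rnormZ t x : rnorm (t%:C *: x) = `|t| * rnorm x.
Proof.
by rewrite /rnorm Zl rdZr mulrA -expr2 sqrtrM ?sqr_ge0 // sqrtr_sqr.
Qed.

Lemma rnormN x : rnorm (- x) = rnorm x.
Proof. by rewrite /rnorm rdNl rdNr opprK. Qed.

Lemma rnormB x y : rnorm (x - y) = rnorm (y - x).
Proof. by rewrite -rnormN opprB. Qed.

Lemma rnorm_dist_triangle x y z : rnorm (x - z) <= rnorm (x - y) + rnorm (y - z).
Proof. by have := rnormD (x - y) (y - z); rewrite addrA subrK. Qed.

Definition closed_sub S := [/\ S 0,
  forall t x y, S x -> S y -> S (t%:C *: x + y) &
  forall x, (forall e : R, 0 < e -> exists2 y, S y & rnorm (x - y) <= e) -> S x].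

(** The nearest point of [S]: the parallelogram law makes a minimising sequence Cauchy, and the
    first variation of the distance at its limit gives orthogonality. *)
Lemma orthogonal_projection S x : closed_sub S ->
  exists y, S y /\ forall z, S z -> rd (x - y) z = 0.
Proof.
move=> [S0 Sl Sc].
pose D := [set rnorm (x - z) | z in S]%classic.
have Dlb : lbound D 0 by move=> _ [z _ <-]; exact: rnorm_ge0.
have Di : has_inf D by split; [exists (rnorm (x - 0)); exists 0 | exists 0].
pose d := inf D.
have d0 : 0 <= d by apply: lb_le_inf => //; case: Di.
have dle z : S z -> d <= rnorm (x - z).
  by move=> Sz; apply: (ge_inf (proj2 Di)); exists z.
have ex (k : nat) : exists y, S y /\ rnorm (x - y) <= d + k.+1%:R^-1.
  have k0 : 0 < k.+1%:R^-1 :> R by rewrite invr_gt0.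
  have [_ [y Sy <-] /ltW h] := inf_adherent k0 Di.
  by exists y.
pose y k := projT1 (cid (ex k)).
have yP k : S (y k) /\ rnorm (x - y k) <= d + k.+1%:R^-1 := projT2 (cid (ex k)).
(* The midpoint of [y m] and [y n] lies in [S], so at distance at least d from x. With e = 1/(N+1)
   <= 1 the parallelogram law leaves 4 (d + e)^2 - 4 d^2 = 8 d e + 4 e^2 <= (8 d + 4) e. *)
have par m n N : (N <= m)%N -> (N <= n)%N ->
    rd (y m - y n) (y m - y n) <= (8 * d + 4) * N.+1%:R^-1.
  move=> Nm Nn.
  have [w wE] : exists w, w = x - y m by eexists.
  have [v vE] : exists v, v = x - y n by eexists.
  have wv : y m - y n = v - w by rewrite vE wE opprB [RHS]addrC subrKA.
  have wle : rnorm w <= d + N.+1%:R^-1.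
    rewrite wE; apply: le_trans (proj2 (yP m)) _.
    by rewrite lerD2l lef_pV2 ?posrE // ler_nat.
  have vle : rnorm v <= d + N.+1%:R^-1.
    rewrite vE; apply: le_trans (proj2 (yP n)) _.
    by rewrite lerD2l lef_pV2 ?posrE // ler_nat.
  have : d <= rnorm ((2^-1)%:C *: (w + v)).
    have -> : (2^-1)%:C *: (w + v) = x - ((2^-1)%:C *: y m + ((2^-1)%:C *: y n + 0)).
      rewrite addr0 -scalerDr -[x in RHS]scale1r.
      rewrite [1 in RHS](_ : 1 = (2^-1)%:C * 2%:R); last first.
        by rewrite -(rmorph_nat (real_complex R)) -rmorphM mulVf.
      by rewrite -scalerA -scalerBr wE vE scaler_nat mulr2n opprD addrACA.
    apply: dle; apply: (Sl); first exact: (yP m).1.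
    by apply: (Sl) => //; exact: (yP n).1.
  rewrite rnormZ ger0_norm // => dl.
  have : d ^+ 2 <= (2^-1 * rnorm (w + v)) ^+ 2.
    by rewrite ler_pXn2r ?nnegrE // mulr_ge0 // rnorm_ge0.
  rewrite exprMn rnorm_sqr wv !Dl !rdDr !rdNl !rdNr (C v w).
  rewrite -!(rnorm_sqr w) -!(rnorm_sqr v).
  set e := N.+1%:R^-1 in wle vle *.
  have e0 : 0 < e by rewrite invr_gt0.
  have e1 : e <= 1 by rewrite invf_le1 // ler1n.
  have w2 : rnorm w ^+ 2 <= (d + e) ^+ 2.
    by rewrite ler_pXn2r ?nnegrE ?rnorm_ge0 // addr_ge0 // ltW.
  have v2 : rnorm v ^+ 2 <= (d + e) ^+ 2.
    by rewrite ler_pXn2r ?nnegrE ?rnorm_ge0 // addr_ge0 // ltW.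
  by nra.
have [|l lP] := rd_complete rdH (u := y).
  move=> e e0; pose K := Num.truncn ((8 * d + 4) / e).
  exists K => m n Km Kn; apply: le_trans (par _ _ K Km Kn) _.
  have := truncnS_gt ((8 * d + 4) / e); rewrite -/K => h.
  rewrite ler_pdivrMr //; move: h; rewrite ltr_pdivrMr // => /ltW.
  by rewrite [leRHS]mulrC.
have lP' (e : R) : 0 < e -> exists N, forall n, (N <= n)%N -> rnorm (y n - l) <= e.
  move=> e0; have [N NP] := lP (e ^+ 2) ltac:(by rewrite exprn_gt0).
  exists N => n /NP h; rewrite -(@ler_pXn2r _ 2) ?nnegrE ?rnorm_ge0 ?(ltW e0) //.
  by rewrite rnorm_sqr.
have Sl' : S l.
  apply: Sc => e e0; have [N NP] := lP' e e0.
  by exists (y N); [exact: (yP N).1 | rewrite rnormB; apply: NP].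
exists l; split=> // z Sz.
have ld : rnorm (x - l) <= d.
  apply/ler_addgt0Pr => e e0.
  have [N NP] := lP' (e / 2) ltac:(lra).
  pose K := Num.truncn (e / 2)^-1; pose n := maxn N K.
  apply: le_trans (rnorm_dist_triangle _ (y n) _) _.
  have h1 := NP n (leq_maxl _ _); have [_ h2] := yP n.
  have h3 : n.+1%:R^-1 <= e / 2.
    rewrite -[leRHS]invrK lef_pV2 ?posrE ?invr_gt0 //; last lra.
    apply: le_trans (ltW (truncnS_gt (e/2)^-1)) _.
    by rewrite ler_nat ltnS leq_maxr.
  move: h1 h2 h3; rewrite -/n; set q := n.+1%:R^-1.
  by set a := rnorm _; set b := rnorm _; lra.
have [u uE] : exists u, u = x - l by eexists.
rewrite -uE in ld *.
have key t : 0 <= - 2 * t * rd u z + t ^+ 2 * rd z z.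
  have h : d <= rnorm (x - (t%:C *: z + l)) by apply: dle; apply: Sl.
  have : rnorm u ^+ 2 <= rnorm (x - (t%:C *: z + l)) ^+ 2.
    by rewrite ler_pXn2r ?nnegrE ?rnorm_ge0 // (le_trans ld).
  have -> : x - (t%:C *: z + l) = u + (- t)%:C *: z.
    by rewrite uE rmorphN scaleNr opprD addrCA addrC.
  rewrite !rnorm_sqr Dl !rdDr !Zl !rdZr (C z).
  move=> k; nra.
have zz := ge0 z; set a := rd u z in key *.
(* Minimising over t suggests t = <u, z> / |z|^2; the [+ 1] keeps the denominator positive when z =
   0. *)
have := key (a / (rd z z + 1)).
set b := (rd z z + 1)^-1 => k.
have b0 : 0 < b by rewrite invr_gt0; lra.
have bz : b * rd z z = 1 - b by rewrite /b; field; lra.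
have bE : (a * b) ^+ 2 * rd z z = a ^+ 2 * b * (b * rd z z) by ring.
rewrite bE bz in k.
have k2 : a ^+ 2 * (b * (1 + b)) <= 0 by nra.
apply/eqP; rewrite -sqrf_eq0 eq_le sqr_ge0 andbT.
by rewrite -(@pmulr_lle0 _ (b * (1 + b))) // mulr_gt0 //; lra.
Qed.

(* Defined as an intersection so that an operator mapping G to itself is seen to
   preserve the closed span by testing it on the preimage of the span. *)
Definition closed_span (G : V -> Prop) x :=
  forall S, closed_sub S -> (forall g, G g -> S g) -> S x.

Lemma closed_span_closed G : closed_sub (closed_span G).
Proof.
split=> [S [] // | t x y Gx Gy S cS GS | x xP S cS GS].
  by case: (cS) => _ Sl _; apply: Sl; [apply: Gx | apply: Gy].
case: (cS) => _ _ Sc; apply: Sc => e /xP [y Gy h].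
by exists y => //; exact: Gy.
Qed.

Lemma orthogonal_closed y : closed_sub (fun x => rd x y = 0).
Proof.
split=> [|t x z hx hz|x xP]; first exact: rd0l.
  by rewrite Dl Zl hx hz mulr0 addr0.
apply/eqP; rewrite -normr_le0; apply/ler_addgt0Pr => e e0; rewrite add0r.
have y1 : 0 < rnorm y + 1 by have := rnorm_ge0 y; lra.
have [z hz h] := xP (e / (rnorm y + 1)) ltac:(by rewrite divr_gt0).
have -> : rd x y = rd (x - z) y by rewrite Dl rdNl hz subr0.
apply: le_trans (rd_CauchySchwarz _ _) _.
move: h; rewrite ler_pdivlMr // => h.
have := rnorm_ge0 (x - z); have := rnorm_ge0 y; nra.
Qed.

End RealHilbert.

(** * Operators in A *)

Section HilbertReal.
Variables (R : realType) (H : hilbertType R).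
Implicit Types (x y z : H).

Definition hre x y : R := complex.Re (hdot x y).

Lemma hdot_normR x : hdot x x = (hre x x)%:C.
Proof.
rewrite /hre; have : 0 <= hdot x x by rewrite hdot_norm exprn_ge0.
by case: (hdot x x) => a b; rewrite lecE /= => /andP[/eqP -> _].
Qed.

Lemma hreDl x y z : hre (x + y) z = hre x z + hre y z.
Proof. by rewrite /hre linearDl raddfD. Qed.

Lemma hreZl (t : R) x y : hre (t%:C *: x) y = t * hre x y.
Proof.
rewrite /hre linearZl_LR /=; case: (hdot x y) => a b /=.
by rewrite mul0r subr0.
Qed.

Lemma hreC x y : hre x y = hre y x.
Proof.
have ReC (z : R[i]) : complex.Re (Num.conj z) = complex.Re z by case: z.
by rewrite /hre hermC expr0 mul1r; exact: ReC.
Qed.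

Lemma hre_ge0 x : 0 <= hre x x.
Proof.
have : 0 <= hdot x x by rewrite hdot_norm exprn_ge0.
by rewrite hdot_normR ler0c.
Qed.

Lemma hre_eq0 x : hre x x = 0 -> x = 0.
Proof.
move=> h; have := hdot_norm x; rewrite hdot_normR h => /esym/eqP.
by rewrite expf_eq0 /= normr_eq0 => /eqP.
Qed.

Lemma norm_hre x : `|x| = (Num.sqrt (hre x x))%:C.
Proof.
apply/eqP; rewrite -(@eqrXn2 _ 2%N) // ?ler0c ?sqrtr_ge0 //.
by rewrite -hdot_norm -rmorphXn sqr_sqrtr ?hre_ge0 // hdot_normR.
Qed.

Lemma hre_complete (u : nat -> H) :
  (forall e : R, 0 < e -> exists N, forall m n, (N <= m)%N -> (N <= n)%N ->
     hre (u m - u n) (u m - u n) <= e) ->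
  exists l, forall e : R, 0 < e -> exists N, forall n, (N <= n)%N ->
     hre (u n - l) (u n - l) <= e.
Proof.
move=> uc.
have : cvg (u @ \oo)%classic.
  apply: cauchy_cvg; apply: cauchy_exP => e e0.
  have eE : e = (complex.Re e)%:C.
    by move: e0; case: e => a b; rewrite ltcE /= => /andP[/eqP ->].
  have r0 : 0 < complex.Re e by move: e0; rewrite eE ltcR.
  have [N NP] := uc ((complex.Re e / 2) ^+ 2) ltac:(by rewrite exprn_gt0 // divr_gt0).
  exists (u N); exists N => // n /= Nn.
  rewrite -ball_normE /ball_ /= norm_hre eE ltcR.
  apply: (@le_lt_trans _ _ (complex.Re e / 2)); last lra.
  rewrite -(@ler_pXn2r _ 2) ?nnegrE ?sqrtr_ge0 ?divr_ge0 // ?(ltW r0) //.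
  by rewrite sqr_sqrtr ?hre_ge0 //; apply: NP.
move=> /cvg_ex [l ul]; exists l => e e0.
have s0 : 0 < (Num.sqrt e)%:C by rewrite ltcR sqrtr_gt0.
move/cvgrPdist_le/(_ _ s0): ul => [N _ NP]; exists N => n /NP /=.
by rewrite distrC norm_hre lecR ler_sqrt // ltW.
Qed.

Lemma hre_hilbert : is_real_hilbert hre.
Proof.
by split; [exact: hreDl | exact: hreZl | exact: hreC | exact: hre_ge0
  | exact: hre_eq0 | exact: hre_complete].
Qed.

Local Notation hnorm := (rnorm hre).

Lemma hnormE x : `|x| = (hnorm x)%:C.
Proof. exact: norm_hre. Qed.

Lemma bounded_opP (T : H -> H) : linear T ->
  continuous T <-> exists2 C : R, 0 <= C & forall x, hnorm (T x) <= C * hnorm x.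
Proof.
move=> lT.
pose T' : {linear H -> H} := HB.pack T (GRing.isLinear.Build _ _ _ _ T lT).
split=> [cT|[C C0 CP]].
  have /linear_boundedP/pinfty_ex_gt0 [M M0 MP] :=
    continuous_linear_bounded 0 (cT 0 : {for 0, continuous T'}).
  have ME : M = (complex.Re M)%:C.
    by move: M0; case: M {MP} => a b; rewrite ltcE /= => /andP[/eqP ->].
  exists (complex.Re M) => [|x]; first by move: M0; rewrite ME ltcR => /ltW.
  by have := MP x; rewrite !hnormE ME -rmorphM lecR.
apply: (@bounded_linear_continuous _ _ _ T'); apply/linear_boundedP.
exists C%:C; split; first by rewrite ger0_real ?ler0c.
move=> r /ltW Cr x; apply: le_trans (_ : C%:C * `|x| <= _).
  by rewrite !hnormE -rmorphM lecR; exact: CP.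
by rewrite ler_wpM2r.
Qed.

End HilbertReal.

(** * Adjoints, positivity and projections in A *)

Section Algebra.
Variables (R : realType) (H : hilbertType R) (A : vnAlgebra H).
Implicit Types (a b c : A) (x y z : H).
Local Notation rd := (@hre R H).
Local Notation rn := (rnorm (@hre R H)).
Let rdH := hre_hilbert H.

Lemma op_linear a : linear (val a).
Proof. by case: (vn_bounded (set_mem (valP a))). Qed.

Lemma opD a x y : val a (x + y) = val a x + val a y.
Proof. by have := op_linear a 1 x y; rewrite !scale1r. Qed.

Lemma op0 a : val a 0 = 0.
Proof. by apply: (addrI (val a 0)); rewrite -opD !addr0. Qed.

Lemma opZ a (t : R[i]) x : val a (t *: x) = t *: val a x.
Proof. by have := op_linear a t x 0; rewrite op0 !addr0. Qed.

Lemma opN a x : val a (- x) = - val a x.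
Proof. by rewrite -scaleN1r opZ scaleN1r. Qed.

Lemma opB a x y : val a (x - y) = val a x - val a y.
Proof. by rewrite opD opN. Qed.

Lemma addopE a b x : val (a + b) x = val a x + val b x.
Proof. by []. Qed.

Lemma oppopE a x : val (- a) x = - val a x.
Proof. by []. Qed.

Lemma subopE a b x : val (a - b) x = val a x - val b x.
Proof. by []. Qed.

Lemma mulopE a b x : val (a * b) x = val a (val b x).
Proof. by []. Qed.

Lemma scaleopE (t : R[i]) a x : val (t *: a) x = t *: val a x.
Proof. by []. Qed.

Lemma oneopE x : val (1 : A) x = x.
Proof. by []. Qed.

Lemma zeroopE x : val (0 : A) x = 0.
Proof. by []. Qed.

Lemma op_ext a b : (forall x, val a x = val b x) -> a = b.
Proof. by move=> h; apply/val_inj/funext. Qed.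

Lemma rd_ext x y : (forall z, rd x z = rd y z) -> x = y.
Proof.
move=> h; apply/eqP; rewrite -subr_eq0; apply/eqP/(rd_eq0 rdH).
by rewrite (rdDl rdH) (rdNl rdH) h subrr.
Qed.

Lemma star_rd a x y : rd (val a x) y = rd x (val (star a) y).
Proof. by rewrite /hre starP. Qed.

Lemma starE a b : (forall x y, rd (val a x) y = rd x (val b y)) -> star a = b.
Proof.
move=> h; apply: op_ext => y; apply: rd_ext => z.
by rewrite hreC -star_rd h hreC.
Qed.

Lemma starK : involutive (@star R H A).
Proof. by move=> a; apply: starE => x y; rewrite hreC -star_rd hreC. Qed.

Lemma starM a b : star (a * b) = star b * star a.
Proof. by apply: starE => x y; rewrite !mulopE !star_rd. Qed.

Lemma starD a b : star (a + b) = star a + star b.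
Proof.
by apply: starE => x y; rewrite !addopE (rdDl rdH) (rdDr rdH) !star_rd.
Qed.

Lemma star0 : star (0 : A) = 0.
Proof. by apply: starE => x y; rewrite !zeroopE (rd0l rdH) (rd0r rdH). Qed.

Lemma star1 : star (1 : A) = 1.
Proof. by apply: starE => x y. Qed.

Lemma starN a : star (- a) = - star a.
Proof.
by apply: starE => x y; rewrite !oppopE (rdNl rdH) (rdNr rdH) !star_rd.
Qed.

Lemma starB a b : star (a - b) = star a - star b.
Proof. by rewrite starD starN. Qed.

Lemma star_sum I (r : seq I) (P : pred I) (F : I -> A) :
  star (\sum_(i <- r | P i) F i) = \sum_(i <- r | P i) star (F i).
Proof. exact: (big_morph (@star R H A) starD star0). Qed.

Lemma starZ (t : R) a : star (t%:C *: a) = t%:C *: star a.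
Proof.
by apply: starE => x y; rewrite !scaleopE (rdZl rdH) (rdZr rdH) !star_rd.
Qed.

Lemma op_bounded a :
  exists2 C : R, 0 <= C & forall x, rn (val a x) <= C * rn x.
Proof.
by have [la /(bounded_opP la)] := vn_bounded (set_mem (valP a)).
Qed.

(** Membership in [A] through the bicommutant property; the supports and the norm limits below enter
    [A] this way. *)
Lemma op_of_commuting (T : H -> H) (C : R) : linear T ->
  0 <= C -> (forall x, rn (T x) <= C * rn x) ->
  (forall U, commutant (vn_ops A) U -> forall x, T (U x) = U (T x)) ->
  exists a, val a = T.
Proof.
move=> lT C0 CT UT; have AT : vn_ops A T.
  rewrite -(vn_bicommutant A); split.
    by split=> //; apply/(bounded_opP lT); exists C.
  by move=> U /UT h; apply/funext => x; rewrite /= h.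
by exists (exist _ T (mem_set AT)).
Qed.

Lemma commutant_comm a (U : H -> H) x :
  commutant (vn_ops A) U -> U (val a x) = val a (U x).
Proof. by case=> _ /(_ _ (set_mem (valP a)))/(congr1 (@^~ x)). Qed.

Lemma hre_i x y : rd x ('i%C *: y) = - rd ('i%C *: x) y.
Proof.
rewrite [LHS]hreC /hre !linearZl_LR /= hermC expr0 mul1r.
have h (z : R[i]) : complex.Re ('i%C * Num.conj z) = - complex.Re ('i%C * z).
  by case: z => s t /=; rewrite !mul0r !mul1r !sub0r.
exact: h.
Qed.

Lemma vn_posP a : vn_pos a <-> star a = a /\ forall x, 0 <= rd (val a x) x.
Proof.
split=> [ap|[sa ap] x].
  have ar x : 0 <= rd (val a x) x by have := ap x; rewrite lecE => /andP[].
  split=> //.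
  (* [hdot (val a x) x] is real, so this form vanishes; polarising it at x + w gives symmetry
     against every y = i w. *)
  have a0 x : rd (val a x) ('i%C *: x) = 0.
    rewrite hre_i /hre linearZl_LR /=; have := ap x; rewrite lecE => /andP[/eqP].
    by case: (hdot _ _) => s t /= -> _; rewrite mul0r mul1r sub0r !oppr0.
  apply: starE => x y; rewrite [RHS]hreC.
  have [w ->] : exists w, y = 'i%C *: w.
    by exists (- 'i%C *: y); rewrite scalerA mulrN -expr2 sqr_i opprK scale1r.
  have := a0 (x + w).
  rewrite opD scalerDr (rdDl rdH) !(rdDr rdH) !a0 add0r addr0 opZ.
  by rewrite (hre_i (val a w)) => /eqP; rewrite subr_eq0 => /eqP.
rewrite lecE /=; apply/andP; split; last exact: ap.
have : hdot (val a x) x = Num.conj (hdot (val a x) x).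
  by rewrite [LHS]starP sa hermC expr0 mul1r.
have h (z : R[i]) : z = Num.conj z -> complex.Im z == 0.
  by case: z => s t /= /(congr1 (@complex.Im R)) /= h; apply/eqP; lra.
exact: h.
Qed.

Lemma sa_eq0 a : star a = a -> (forall x, rd (val a x) x = 0) -> a = 0.
Proof.
move=> sa a0; apply: op_ext => x; apply: rd_ext => y.
have := a0 (x + y); rewrite opD (rdDl rdH) !(rdDr rdH) !a0.
rewrite [rd (val a y) x]star_rd sa [rd y _]hreC zeroopE (rd0l rdH).
by move=> h; lra.
Qed.

Lemma vn_pos_sa a : vn_pos a -> star a = a.
Proof. by case/vn_posP. Qed.

Lemma vn_pos_star a : vn_pos (star a * a).
Proof.
apply/vn_posP; split=> [|x]; first by rewrite starM starK.
by rewrite mulopE hreC -star_rd (rd_ge0 rdH).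
Qed.

Lemma vn_pos0 : vn_pos (0 : A).
Proof. by have := vn_pos_star 0; rewrite mulr0. Qed.

Lemma vn_posD a b : vn_pos a -> vn_pos b -> vn_pos (a + b).
Proof.
move=> /vn_posP[sa pa] /vn_posP[sb pb]; apply/vn_posP.
split=> [|x]; first by rewrite starD sa sb.
by rewrite addopE (rdDl rdH) addr_ge0.
Qed.

Lemma vn_pos_sum I (r : seq I) (P : pred I) (F : I -> A) :
  (forall i, P i -> vn_pos (F i)) -> vn_pos (\sum_(i <- r | P i) F i).
Proof.
by move=> h; elim/big_ind: _ => //; [exact: vn_pos0 | exact: vn_posD].
Qed.

Lemma is_proj_pos a : is_proj a -> vn_pos a.
Proof. by move=> [aa sa]; rewrite -aa -{1}sa; exact: vn_pos_star. Qed.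

Lemma is_proj_rd a x : is_proj a -> rd (val a x) x = rn (val a x) ^+ 2.
Proof.
by move=> [aa sa]; rewrite (rnorm_sqr rdH) [RHS]star_rd sa -mulopE aa hreC.
Qed.

Lemma is_proj_compl a : is_proj a -> is_proj (1 - a).
Proof.
move=> [aa sa]; split; last by rewrite starB star1 sa.
by rewrite mulrBl mul1r mulrBr mulr1 aa subrr subr0.
Qed.

Lemma is_proj0 : is_proj (0 : A).
Proof. by split; [rewrite mulr0 | rewrite star0]. Qed.

Lemma star_mul_eq0 a : star a * a = 0 -> a = 0.
Proof.
move=> h; apply: op_ext => x; apply: (rd_eq0 rdH).
by rewrite star_rd -mulopE h zeroopE (rd0r rdH).
Qed.

Lemma vn_leP a b : vn_le a b -> forall x, rd (val a x) x <= rd (val b x) x.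
Proof.
move=> /vn_posP[_ h] x; have := h x.
by rewrite subopE (rdDl rdH) (rdNl rdH) subr_ge0.
Qed.

Lemma vn_le_refl a : vn_le a a.
Proof. by rewrite /vn_le subrr; exact: vn_pos0. Qed.

Lemma vn_le_trans a b c : vn_le a b -> vn_le b c -> vn_le a c.
Proof. by move=> h k; rewrite /vn_le -(subrK b c) -addrA; exact: vn_posD. Qed.

Lemma proj_sub_le a b : is_proj a -> is_proj b -> b * a = a -> vn_le a b.
Proof.
move=> [aa sa] [bb sb] ba.
have ab : a * b = a by have := congr1 (@star R H A) ba; rewrite starM sa sb.
apply: is_proj_pos; split; last by rewrite starB sa sb.
by rewrite mulrBl !mulrBr bb ba ab aa subrr subr0.
Qed.

(** On the range of [1 - b] the form of [b] vanishes, hence so does that of [a], and thus [a]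
    itself. *)
Lemma proj_le_mul a b : is_proj a -> is_proj b -> vn_le a b -> a * b = a.
Proof.
move=> pa pb /vn_leP ab; apply: op_ext => x.
apply/eqP; rewrite -subr_eq0 -opprB oppr_eq0; apply/eqP; apply: (rnorm_eq0 rdH).
have -> : val a x - val (a * b) x = val a (val (1 - b) x).
  by rewrite subopE opB.
have := ab (val (1 - b) x); rewrite is_proj_rd //.
have hb : val b (val (1 - b) x) = 0.
  by rewrite -mulopE mulrBr mulr1 (proj1 pb) subrr.
rewrite hb (rd0l rdH) => h.
by apply/eqP; rewrite -sqrf_eq0 eq_le h sqr_ge0.
Qed.

Lemma is_proj_contr a x : is_proj a -> rn (val a x) <= rn x.
Proof.
move=> pa; rewrite -(@ler_pXn2r _ 2) ?nnegrE ?rnorm_ge0 // -is_proj_rd //.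
have /vn_posP[_ /(_ x)] := is_proj_pos (is_proj_compl pa).
by rewrite subopE (rdDl rdH) (rdNl rdH) subr_ge0 (rnorm_sqr rdH).
Qed.

End Algebra.

(** * Supports *)

Section MatrixOperators.
Variables (R : realType) (H : hilbertType R) (A : vnAlgebra H) (n : nat).
Implicit Types (P Q : 'M[A]_n) (u v w : 'I_n -> H).
Local Notation rd := (@hre R H).
Local Notation rn := (rnorm (@hre R H)).
Let rdH := hre_hilbert H.

Definition hren u v : R := \sum_i rd (u i) (v i).

Lemma le_hren u i : rd (u i) (u i) <= hren u u.
Proof.
rewrite /hren (bigD1 i) //= lerDl; apply: sumr_ge0 => j _; exact: (rd_ge0 rdH).
Qed.

Lemma hren_hilbert : is_real_hilbert hren.
Proof.
split.
- move=> x y z; rewrite -big_split /=; apply: eq_bigr => i _; exact: (rdDl rdH).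
- move=> t x y; rewrite /hren mulr_sumr; apply: eq_bigr => i _.
  exact: (rdZl rdH).
- move=> x y; apply: eq_bigr => i _; exact: hreC.
- by move=> x; apply: sumr_ge0 => i _; exact: (rd_ge0 rdH).
- move=> x x0; apply/funext => i; apply: (rd_eq0 rdH); apply/eqP.
  by rewrite eq_le (rd_ge0 rdH) andbT -x0 le_hren.
move=> u uc.
have ex i : exists l, forall e : R, 0 < e -> exists N, forall k, (N <= k)%N ->
    rd (u k i - l) (u k i - l) <= e.
  apply: (rd_complete rdH (u := fun k => u k i)) => e /uc [N NP].
  exists N => k m Nk Nm; apply: le_trans (NP k m Nk Nm).
  exact: (le_hren (u k - u m)).
pose l i := projT1 (cid (ex i)).
have lP i : forall e : R, 0 < e -> exists N, forall k, (N <= k)%N ->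
    rd (u k i - l i) (u k i - l i) <= e := projT2 (cid (ex i)).
exists l => e e0.
(* [n.+1] rather than [n], which may be 0. *)
have e1 : 0 < e / n.+1%:R by rewrite divr_gt0.
pose N i := projT1 (cid (lP i _ e1)).
have NP i : forall k, (N i <= k)%N -> rd (u k i - l i) (u k i - l i) <= e / n.+1%:R :=
  projT2 (cid (lP i _ e1)).
exists (\max_i N i)%N => k kN; rewrite /hren.
apply: (@le_trans _ _ (\sum_(i < n) e / n.+1%:R)).
  apply: ler_sum => i _; apply: NP; apply: leq_trans kN; exact: leq_bigmax.
rewrite sumr_const card_ord -[_ *+ n]mulr_natr mulrAC ler_pdivrMr //.
by rewrite ler_wpM2l ?(ltW e0) // ler_nat.
Qed.

Local Notation rdV := hren_hilbert.
Local Notation rnV := (rnorm hren).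

Definition mxop P v : 'I_n -> H := fun i => \sum_j val (P i j) (v j).

Definition mxstar P : 'M[A]_n := (map_mx (@star R H A) P)^T.

Lemma mxop_linear P (t : R[i]) u v : mxop P (t *: u + v) = t *: mxop P u + mxop P v.
Proof.
apply/funext => i; rewrite /mxop /= [LHS](_ : _ =
  \sum_j (t *: val (P i j) (u j) + val (P i j) (v j))); last first.
  by apply: eq_bigr => j _; rewrite -op_linear.
by rewrite big_split /= -scaler_sumr.
Qed.

Lemma valop_sum I (s : seq I) (F : I -> A) x :
  val (\sum_(i <- s) F i) x = \sum_(i <- s) val (F i) x.
Proof. exact: (big_morph (fun a : A => val a x)). Qed.

Lemma op_sum (a : A) I (s : seq I) (F : I -> H) :
  val a (\sum_(i <- s) F i) = \sum_(i <- s) val a (F i).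
Proof. exact: (big_morph (val a) (opD a) (op0 a)). Qed.

Lemma mxopM P Q v : mxop (P *m Q) v = mxop P (mxop Q v).
Proof.
apply/funext => i; rewrite /mxop; under eq_bigr do rewrite mxE valop_sum.
by rewrite exchange_big; apply: eq_bigr => j _; rewrite op_sum.
Qed.

Lemma mxstar_hren P u v : hren (mxop P u) v = hren u (mxop (mxstar P) v).
Proof.
rewrite /hren /mxop.
transitivity (\sum_i \sum_j rd (u j) (val (mxstar P j i) (v i))).
  apply: eq_bigr => i _.
  rewrite (big_morph (fun x => rd x (v i)) (fun x y => rdDl rdH x y _) (rd0l rdH _)).
  by apply: eq_bigr => j _; rewrite star_rd !mxE.
rewrite exchange_big; apply: eq_bigr => i _.
by rewrite (big_morph (rd (u i)) (rdDr rdH _) (rd0r rdH _)).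
Qed.

Definition inj_at (j : 'I_n) (h : H) : 'I_n -> H := fun k => if k == j then h else 0.

Lemma mxop_inj_at P j h i : mxop P (inj_at j h) i = val (P i j) h.
Proof.
rewrite /mxop (bigD1 j) //= /inj_at eqxx big1 ?addr0 // => k /negPf ->.
by rewrite op0.
Qed.

Lemma mxop_ext P Q : (forall v, mxop P v = mxop Q v) -> P = Q.
Proof.
move=> h; apply/matrixP => i j; apply: op_ext => x.
by rewrite -!mxop_inj_at h.
Qed.

Lemma inj_at_sum v : v = \sum_j inj_at j (v j).
Proof.
apply/funext => i; rewrite fct_sumE (bigD1 i) //= /inj_at eqxx big1 ?addr0 //.
by move=> k; rewrite eq_sym => /negPf ->.
Qed.

Lemma hren_inj_at j h : hren (inj_at j h) (inj_at j h) = rd h h.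
Proof.
rewrite /hren (bigD1 j) //= /inj_at eqxx big1 ?addr0 // => k /negPf ->.
exact: (rd0l rdH).
Qed.

Lemma commutant_hnorm (U : H -> H) : commutant (vn_ops A) U ->
  exists2 C : R, 0 <= C & forall x, rn (U x) <= C * rn x.
Proof. by case=> [[lU cU] _]; apply/(bounded_opP lU). Qed.

(* The projection onto the closed span of the ranges of the adjoints T_k*. The
   operators of the commutant, applied coordinatewise, preserve this span and its
   orthogonal (the common kernel of the T_k), so they commute with the projection,
   whose entries therefore lie in A by the bicommutant property. *)
Lemma mx_support I (T : I -> 'M[A]_n) : exists r : 'M[A]_n,
  [/\ is_mxproj r, forall k, T k *m r = T k,
      forall v, (forall k, mxop (T k) v = 0) -> mxop r v = 0 &
      forall S, closed_sub hren S -> (forall k v, S (mxop (mxstar (T k)) v)) ->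
        forall v, S (mxop r v)].
Proof.
pose L := closed_span hren (fun g => exists k v, g = mxop (mxstar (T k)) v).
have Lc : closed_sub hren L by exact: closed_span_closed.
have LG k v : L (mxop (mxstar (T k)) v) by move=> S _; apply; exists k, v.
have [L0 Ll Lcl] := Lc.
have LperpP x : (forall z, L z -> hren x z = 0) <-> forall k, mxop (T k) x = 0.
  split=> [h k|h z Lz].
    by apply: (rd_eq0 rdV); rewrite mxstar_hren h.
  rewrite (rdC rdV); apply: (Lz (fun z => hren z x = 0)).
    exact: orthogonal_closed rdV x.
  by move=> _ [k [v ->]]; rewrite (rdC rdV) -mxstar_hren h (rd0l rdV).
pose E x := projT1 (cid (orthogonal_projection rdV x Lc)).
have EP x : L (E x) /\ forall z, L z -> hren (x - E x) z = 0 :=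
  projT2 (cid (orthogonal_projection rdV x Lc)).
have Euniq x y : L y -> (forall z, L z -> hren (x - y) z = 0) -> E x = y.
  move=> Ly h; have [LE hE] := EP x.
  have Lz : L (E x - y).
    by have := Ll (-1) y (E x) Ly LE; rewrite rmorphN1 scaleN1r addrC.
  apply/eqP; rewrite -subr_eq0; apply/eqP/(rd_eq0 rdV).
  have := h _ Lz; have := hE _ Lz.
  rewrite !(rdDl rdV) !(rdNl rdV) => h1 h2; lra.
have ET x k : mxop (T k) (x - E x) = 0 by have [_ /LperpP] := EP x.
have Ecomm (F : ('I_n -> H) -> 'I_n -> H) (C : R) :
    (forall (t : R) x y, F (t%:C *: x + y) = t%:C *: F x + F y) ->
    0 <= C -> (forall x, rnV (F x) <= C * rnV x) ->
    (forall P v, F (mxop P v) = mxop P (F v)) ->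
    forall x, E (F x) = F (E x).
  move=> Fl C0 FC FP x.
  have FB y z : F (y - z) = F y - F z.
    by have := Fl (-1) z y; rewrite !rmorphN1 !scaleN1r (addrC (- z)) (addrC (- F z)).
  have F0 : F 0 = 0 by have := FB 0 0; rewrite !subrr.
  apply: Euniq.
    have [LE _] := EP x; move: LE; apply: (_ : forall y, L y -> L (F y)) => y Ly.
    apply: (Ly (fun z => L (F z))) => [|_ [k [v ->]]]; last by rewrite FP.
    split=> [|t a b La Lb|a aP]; first by rewrite F0.
      by rewrite Fl; apply: Ll.
    apply: Lcl => e e0; have C1 : 0 < C + 1 by lra.
    have [b Lb ab] := aP (e / (C + 1)) ltac:(by rewrite divr_gt0).
    exists (F b) => //; rewrite -FB; apply: le_trans (FC _) _.
    move: ab; rewrite ler_pdivlMr //; have := rnorm_ge0 hren (a - b); nra.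
  by apply/LperpP => k; rewrite -FB -FP ET F0.
(* [closed_sub] knows real scalars only; for a complex t, homogeneity is [Ecomm] applied to
   multiplication by t. *)
have Elin (t : R[i]) x y : E (t *: x + y) = t *: E x + E y.
  have ED a b : E (a + b) = E a + E b.
    have [La ha] := EP a; have [Lb hb] := EP b; apply: Euniq.
      by have := Ll 1 _ _ La Lb; rewrite scale1r.
    by move=> z Lz; rewrite opprD addrACA (rdDl rdV) ha // hb // addr0.
  rewrite ED; congr (_ + _).
  apply: (Ecomm (fun v => t *: v) (complex.Re `|t|)).
  - by move=> s a b; rewrite scalerDr !scalerA mulrC.
  - by have := normr_ge0 t; rewrite lecE => /andP[].
  - move=> a; have tE : `|t| = (complex.Re `|t|)%:C.
      have : 0 <= `|t| by []. by case: `|t| => p q; rewrite lecE /= => /andP[/eqP ->].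
    rewrite le_eqVlt; apply/orP; left; apply/eqP.
    have t0 : 0 <= complex.Re `|t| by have := normr_ge0 t; rewrite lecE => /andP[].
    rewrite /rnorm -{1}(ger0_norm t0) -sqrtr_sqr -sqrtrM ?sqr_ge0 //.
    congr Num.sqrt; rewrite /hren mulr_sumr; apply: eq_bigr => i _.
    rewrite -!(rnorm_sqr rdH) -exprMn; congr (_ ^+ 2).
    have : (rn (t *: a i))%:C = `|t| * (rn (a i))%:C by rewrite -!hnormE normrZ.
    by rewrite tE -rmorphM => /(congr1 (@complex.Re R)).
  - by move=> P v; have := mxop_linear P t v 0; rewrite !addr0 => ->;
      rewrite [mxop P 0](_ : _ = 0) ?addr0 //; apply/funext => i;
      rewrite /mxop big1 // => j _; exact: op0.
have Eself x y : hren (E x) y = hren x (E y).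
  have [Lx hx] := EP x; have [Ly hy] := EP y.
  have := hx _ Ly; have := hy _ Lx; rewrite !(rdDl rdV) !(rdNl rdV).
  rewrite (rdC rdV y) (rdC rdV (E y)) => h1 h2; lra.
have Enorm x : rnV (E x) <= rnV x.
  rewrite -(@ler_pXn2r _ 2) ?nnegrE ?rnorm_ge0 // !(rnorm_sqr rdV).
  have [Lx /(_ _ Lx)] := EP x; have := rd_ge0 rdV (x - E x).
  rewrite !(rdDl rdV) !(rdDr rdV) !(rdNl rdV) !(rdNr rdV) (rdC rdV (E x) x) => h1 h2.
  lra.
have rex i j : exists a : A, val a = fun h => E (inj_at j h) i.
  apply: (@op_of_commuting _ _ _ _ 1) => //.
  - move=> t x y; have -> : inj_at j (t *: x + y) = t *: inj_at j x + inj_at j y.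
      apply/funext => k; rewrite /inj_at /=.
      by rewrite !fctE; case: ifP => //; rewrite scaler0 addr0.
    by rewrite Elin.
  - move=> x; rewrite mul1r -(@ler_pXn2r _ 2) ?nnegrE ?rnorm_ge0 //.
    rewrite !(rnorm_sqr rdH) -(hren_inj_at j x) -(rnorm_sqr rdV).
    apply: le_trans (le_hren _ _) _; rewrite -(rnorm_sqr rdV).
    by rewrite ler_pXn2r ?nnegrE ?rnorm_ge0 // Enorm.
  - move=> U AU x; have [C C0 CP] := commutant_hnorm AU.
    have lU : linear U by exact: commutant_linear AU.
    have U0 : U 0 = 0.
      have := lU 1 0 0; rewrite !scale1r addr0 => h.
      by apply: (addrI (U 0)); rewrite addr0 -h.
    have -> : inj_at j (U x) = U \o inj_at j x.
      by apply/funext => k; rewrite /inj_at /=; case: ifP.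
    rewrite (Ecomm (fun v => U \o v) C) //.
    + by move=> t a b; apply/funext => k; rewrite /= !fctE lU.
    + move=> a; rewrite -(@ler_pXn2r _ 2) ?nnegrE ?mulr_ge0 ?rnorm_ge0 //.
      rewrite exprMn !(rnorm_sqr rdV) /hren mulr_sumr; apply: ler_sum => k _.
      rewrite -!(rnorm_sqr rdH) -exprMn ler_pXn2r ?nnegrE ?mulr_ge0 ?rnorm_ge0 //.
      exact: CP.
    + move=> P v; apply/funext => k; rewrite /mxop /=.
      have UD a b : U (a + b) = U a + U b by have := lU 1 a b; rewrite !scale1r.
      rewrite (big_morph U UD U0); apply: eq_bigr => m _; exact: commutant_comm.
pose r : 'M[A]_n := \matrix_(i, j) projT1 (cid (rex i j)).
have rE v : mxop r v = E v.
  apply/funext => i; rewrite {2}(inj_at_sum v).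
  have E0 : E 0 = 0.
    have := Elin 1 0 0; rewrite !scale1r addr0 => h.
    by apply: (addrI (E 0)); rewrite addr0 -h.
  have ED a b : E (a + b) = E a + E b by have := Elin 1 a b; rewrite !scale1r.
  rewrite (big_morph E ED E0) fct_sumE; apply: eq_bigr => j _.
  by rewrite mxE (projT2 (cid (rex i j))).
exists r; split.
- split; apply: mxop_ext => v.
    have [LE _] := EP v.
    by rewrite mxopM !rE; apply: Euniq => // z _; rewrite subrr (rd0l rdV).
  apply/eqP; rewrite -subr_eq0; apply/eqP/(rd_eq0 rdV).
  set w := _ - _; rewrite {1}/w (rdDl rdV) (rdNl rdV) -[X in mxop X v]/(mxstar r).
  by rewrite (rdC rdV) -mxstar_hren !rE Eself (rdC rdV) subrr.
- move=> k; apply: mxop_ext => v; rewrite mxopM rE.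
  apply/eqP; rewrite eq_sym -subr_eq0; apply/eqP; rewrite -[RHS](ET v k).
  have h := mxop_linear (T k) (-1) (E v) v; rewrite !scaleN1r in h.
  by rewrite addrC -h addrC.
- move=> v vT; rewrite rE; apply: Euniq => // z Lz.
  by rewrite subr0; move/LperpP: vT; apply.
- move=> S Sc SG v; rewrite rE; have [LE _] := EP v.
  by apply: LE => // _ [k [w ->]].
Qed.

End MatrixOperators.

(** * Supports in A and sequences of projections increasing to 1 *)

Section Supports.
Variables (R : realType) (H : hilbertType R) (A : vnAlgebra H).
Implicit Types (a b c : A) (x y z : H) (p : nat -> A).
Local Notation rd := (@hre R H).
Local Notation rn := (rnorm (@hre R H)).
Let rdH := hre_hilbert H.

(** The case of 1 by 1 matrices. The last clause serves as an induction principle for properties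
    that define a closed subspace. *)
Lemma joint_support I (T : I -> A) : exists e : A,
  [/\ is_proj e, forall k, T k * e = T k,
      forall x, (forall k, val (T k) x = 0) -> val e x = 0 &
      forall S, closed_sub rd S -> (forall k x, S (val (star (T k)) x)) ->
        forall x, S (val e x)].
Proof.
have [r [[rr rs] Tr rker rspan]] := mx_support (fun k => (const_mx (T k) : 'M[A]_1)).
have op1 (P : 'M[A]_1) x : mxop P (fun=> x) = fun=> val (P ord0 ord0) x.
  by apply/funext => i; rewrite /mxop big_ord1 (ord1 i).
exists (r ord0 ord0); split.
- split; last by have := congr1 (fun m : 'M[A]_1 => m ord0 ord0) rs; rewrite !mxE.
  by have := congr1 (fun m : 'M[A]_1 => m ord0 ord0) rr; rewrite !mxE big_ord1.
- by move=> k; have := congr1 (fun m : 'M[A]_1 => m ord0 ord0) (Tr k);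
    rewrite !mxE big_ord1 !mxE.
- move=> x xT; have h : mxop r (fun=> x) = 0.
    by apply: rker => k; rewrite op1; apply/funext => i; rewrite mxE xT.
  by have := congr1 (@^~ ord0) h; rewrite op1.
- move=> S [S0 Sl Scl] ST x.
  have := rspan (fun v => S (v ord0)).
  rewrite -[val _ _]/((fun=> val (r ord0 ord0) x) (ord0 : 'I_1)) -op1.
  apply; last by move=> k v; rewrite /mxop big_ord1 !mxE; exact: ST.
  split=> // [t u v|v vP]; first exact: Sl.
  apply: Scl => e /vP[u Su h]; exists (u ord0) => //.
  by move: h; rewrite /rnorm /hren big_ord1.
Qed.

Lemma proj_chain p : (forall n, is_proj (p n)) ->
  (forall n, vn_le (p n) (p n.+1)) ->
  forall m n, (m <= n)%N -> p m * p n = p m /\ p n * p m = p m.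
Proof.
move=> pp pi m n mn.
have le : vn_le (p m) (p n).
  elim: n mn => [|n IH]; first by rewrite leqn0 => /eqP ->; exact: vn_le_refl.
  rewrite leq_eqVlt => /predU1P[->|]; first exact: vn_le_refl.
  by move=> /IH h; exact: vn_le_trans h (pi n).
have h := proj_le_mul (pp m) (pp n) le; split=> //.
by have := congr1 (@star R H A) h; rewrite starM (pp m).2 (pp n).2.
Qed.

(** The joint support of the [p n] is 1, and the vectors x with p_n x -> x form a closed subspace
    containing the range of every [p n], hence all of H. *)
Lemma strong_cvg p : (forall n, is_proj (p n)) ->
  (forall n, vn_le (p n) (p n.+1)) ->
  (forall x, (forall n, val (p n) x = 0) -> x = 0) ->
  forall x (e : R), 0 < e -> exists n, rn (x - val (p n) x) <= e.
Proof.
move=> pp pi pker.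
have [e1 [pe1 Te kere spane]] := joint_support p.
have e1E x : val e1 x = x.
  apply/eqP; rewrite eq_sym -subr_eq0; apply/eqP/pker => n.
  by rewrite opB -mulopE Te subrr.
pose S x := forall e : R, 0 < e -> exists n, rn (x - val (p n) x) <= e.
(* The error decreases with n, so a single index can serve two vectors. *)
have mono x m n : (m <= n)%N -> rn (x - val (p n) x) <= rn (x - val (p m) x).
  move=> mn; have [h k] := proj_chain pp pi mn.
  have -> : x - val (p n) x = val (1 - p n) (x - val (p m) x).
    rewrite opB subopE oneopE -[val _ (val (p m) x)]mulopE mulrBl mul1r k.
    by rewrite subrr subr0.
  exact: is_proj_contr (is_proj_compl (pp n)).
suff Sx : forall x, S (val e1 x) by move=> x; have := Sx x; rewrite e1E.
apply: spane; last first.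
  move=> k x e e0; exists k; rewrite (pp k).2 -mulopE (pp k).1 subrr.
  by rewrite /rnorm (rd0l rdH) sqrtr0 ltW.
split=> [e e0|t x y Sx Sy e e0|x xP e e0].
- by exists 0%N; rewrite op0 subrr /rnorm (rd0l rdH) sqrtr0 ltW.
- have t1 : 0 < `|t| + 1 by have := normr_ge0 t; lra.
  have [m hm] := Sx (e / 2 / (`|t| + 1)) ltac:(by rewrite !divr_gt0).
  have [n hn] := Sy (e / 2) ltac:(by rewrite divr_gt0).
  exists (maxn m n).
  have hm' := le_trans (mono x _ _ (leq_maxl m n)) hm.
  have hn' := le_trans (mono y _ _ (leq_maxr m n)) hn.
  rewrite op_linear opprD addrACA -scalerBr.
  apply: le_trans (rnormD rdH _ _) _; rewrite (rnormZ rdH).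
  move: hm'; rewrite ler_pdivlMr // => hm'.
  have := rnorm_ge0 rd (x - val (p (maxn m n)) x); have := normr_ge0 t.
  set q := rn (x - _) in hm' *; set r := rn (y - _) in hn' *; nra.
- have [y Sy xy] := xP (e / 3) ltac:(by rewrite divr_gt0).
  have [n hn] := Sy (e / 3) ltac:(by rewrite divr_gt0).
  exists n.
  have -> : x - val (p n) x = (x - y) + (y - val (p n) y) - val (p n) (x - y).
    by rewrite opB opprB !subrKA.
  apply: le_trans (rnormD rdH _ _) _; rewrite (rnormN rdH).
  have := rnormD rdH (x - y) (y - val (p n) y).
  have := is_proj_contr (x - y) (pp n); set q := rn (val _ _).
  set r := rn (x - y + _); move: xy hn; set s := rn (x - y); set u := rn (y - _).
  by move=> h1 h2 h3 h4; lra.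
Qed.

Lemma strong_sup p : (forall n, is_proj (p n)) ->
  (forall n, vn_le (p n) (p n.+1)) ->
  (forall x, (forall n, val (p n) x = 0) -> x = 0) ->
  forall x (c : R), (forall n, rd (val (p n) x) x <= c) -> rd x x <= c.
Proof.
move=> pp pi pker x c xc.
have c0 : 0 <= c by apply: le_trans (xc 0%N); rewrite is_proj_rd ?sqr_ge0.
suff : rn x <= Num.sqrt c by rewrite /rnorm ler_sqrt.
apply/ler_addgt0Pr => e e0.
have [n hn] := strong_cvg pp pi pker x e0.
rewrite -[X in rn X](subrK (val (p n) x)).
apply: le_trans (rnormD rdH _ _) _; rewrite addrC lerD //.
rewrite -(@ler_pXn2r _ 2) ?nnegrE ?rnorm_ge0 ?sqrtr_ge0 //.
by rewrite [leRHS]sqr_sqrtr // -is_proj_rd.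
Qed.

(** The joint support of the [p n] is itself an upper bound in [A], so a supremum equal to 1 forces
    a trivial common kernel; strong convergence gives the converse. *)
Lemma increases_to_1P p : (forall n, is_proj (p n)) ->
  (forall n, vn_le (p n) (p n.+1)) ->
  increases_to_1 p <-> (forall x, (forall n, val (p n) x = 0) -> x = 0).
Proof.
move=> pp pi; split=> [[_ [_ psup]] x xp|pker].
  have [e [pe Te kere _]] := joint_support p.
  have /vn_leP/(_ x) : vn_le 1 e.
    apply: psup => _ [n _ <-]; apply: proj_sub_le => //.
    by have := congr1 (@star R H A) (Te n); rewrite starM (pp n).2 pe.2.
  rewrite kere // (rd0l rdH) oneopE => h; apply: (rd_eq0 rdH).
  by apply/eqP; rewrite eq_le h (rd_ge0 rdH).
split=> //; split=> [_ [n _ <-]|c cp].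
  by apply: proj_sub_le => //; [split; rewrite ?mulr1 ?star1 | rewrite mul1r].
apply/vn_posP; split=> [|x].
  (* [c - p 0] is self-adjoint, hence so is [c]. *)
  have /vn_pos_sa := cp _ (ex_intro2 _ _ 0%N I erefl).
  by rewrite !starB star1 (pp 0%N).2 => /addIr ->.
rewrite subopE (rdDl rdH) (rdNl rdH) subr_ge0.
apply: (strong_sup pp pi pker) => n; apply: vn_leP; exact: cp.
Qed.

Lemma conj_le a b c : vn_le a b -> vn_le (star c * a * c) (star c * b * c).
Proof.
rewrite /vn_le -mulrBl -mulrBr => /vn_posP[sa h]; apply/vn_posP.
split=> [|x]; first by rewrite !starM starK sa mulrA.
by rewrite !mulopE hreC -star_rd hreC.
Qed.

(** The shape in which normality is applied; minimality is checked by [strong_sup] at the vectors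
    [val c x]. *)
Lemma conj_increases p c : (forall n, is_proj (p n)) -> increases_to_1 p ->
  vn_is_sup (range (fun n => star c * p n * c)) (star c * c).
Proof.
move=> pp p1; have [pi [pub _]] := p1.
have pker := (increases_to_1P pp pi).1 p1.
split=> [_ [n _ <-]|d dp].
  by rewrite -[X in vn_le _ (X * c)]mulr1; apply: conj_le; apply: pub; exists n.
apply/vn_posP; split=> [|x].
  have /vn_pos_sa := dp _ (ex_intro2 _ _ 0%N I erefl).
  by rewrite !starB !starM starK (pp 0%N).2 mulrA => /addIr ->.
rewrite subopE (rdDl rdH) (rdNl rdH) subr_ge0.
rewrite mulopE hreC -star_rd.
apply: (strong_sup pp pi pker) => n.
have /vn_leP/(_ x) := dp _ (ex_intro2 _ _ n I erefl).
by rewrite !mulopE hreC -star_rd hreC.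
Qed.

End Supports.

(** * Spectral projections *)

Section NormBounds.
Variables (R : realType) (H : hilbertType R) (A : vnAlgebra H).
Implicit Types (a b c : A) (x y z : H) (s t : R) (Z : nat -> A).
Local Notation rd := (@hre R H).
Local Notation rn := (rnorm (@hre R H)).
Let rdH := hre_hilbert H.

(** Bounds are carried as a relation, so no operator norm has to be formed as a supremum. *)
Definition opb a s := forall x, rn (val a x) <= s * rn x.

Lemma opbD a b s t : opb a s -> opb b t -> opb (a + b) (s + t).
Proof.
move=> ha hb x; rewrite mulrDl; apply: le_trans (rnormD rdH _ _) _.
by rewrite lerD.
Qed.

Lemma opbM a b s t : 0 <= s -> opb a s -> opb b t -> opb (a * b) (s * t).
Proof.
by move=> s0 ha hb x; apply: le_trans (ha _) _; rewrite -mulrA ler_wpM2l.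
Qed.

Lemma opbN a s : opb a s -> opb (- a) s.
Proof. by move=> ha x; rewrite oppopE (rnormN rdH). Qed.

Lemma opbZ (t : R) a s : 0 <= t -> opb a s -> opb (t%:C *: a) (t * s).
Proof.
move=> t0 ha x; rewrite scaleopE (rnormZ rdH) ger0_norm // -mulrA.
by rewrite ler_wpM2l.
Qed.

Lemma opb1 : opb (1 : A) 1.
Proof. by move=> x; rewrite mul1r. Qed.

Lemma opb0 : opb (0 : A) 0.
Proof. by move=> x; rewrite zeroopE mul0r /rnorm (rd0l rdH) sqrtr0. Qed.

Lemma opb_le a s t : s <= t -> opb a s -> opb a t.
Proof.
by move=> st ha x; apply: le_trans (ha x) _; rewrite ler_wpM2r ?rnorm_ge0.
Qed.

Lemma opb_star a s : 0 <= s -> opb a s -> opb (star a) s.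
Proof.
move=> s0 ha x; set y := val (star a) x.
have [y0|y0] := eqVneq (rn y) 0; first by rewrite y0 mulr_ge0 ?rnorm_ge0.
have yp : 0 < rn y by rewrite lt_def y0 rnorm_ge0.
rewrite -(ler_pM2r yp) -expr2 (rnorm_sqr rdH) {1}/y hreC -star_rd.
apply: le_trans (ler_norm _) _; apply: le_trans (rd_CauchySchwarz rdH _ _) _.
by rewrite mulrAC ler_wpM2r ?rnorm_ge0 //; exact: ha.
Qed.

Definition ncvg Z a := forall s, 0 < s ->
  exists N, forall n, (N <= n)%N -> opb (Z n - a) s.

Lemma ncvg_unique Z a b : ncvg Z a -> ncvg Z b -> a = b.
Proof.
move=> ha hb; apply: op_ext => x; apply/eqP; rewrite -subr_eq0; apply/eqP.
apply: (rnorm_eq0 rdH); apply/eqP; rewrite eq_le rnorm_ge0 andbT.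
apply/ler_addgt0Pr => e e0; rewrite add0r.
have x1 : 0 < rn x + 1 by have := rnorm_ge0 rd x; lra.
have e1 : 0 < e / 2 / (rn x + 1) by rewrite !divr_gt0.
have [N NP] := ha _ e1; have [M MP] := hb _ e1.
have := NP _ (leq_maxl N M) x; have := MP _ (leq_maxr N M) x.
set k := maxn N M; rewrite !subopE => h1 h2.
apply: le_trans (rnorm_dist_triangle rdH _ (val (Z k) x) _) _.
rewrite (rnormB rdH (val a x)).
have : e / 2 / (rn x + 1) * rn x <= e / 2.
  rewrite mulrAC ler_pdivrMr // ler_wpM2l //; lra.
move: h1 h2; set p := rn _; set q := rn _; set r := _ * rn x; lra.
Qed.

Lemma ncvgD Z Z' a b : ncvg Z a -> ncvg Z' b -> ncvg (fun n => Z n + Z' n) (a + b).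
Proof.
move=> ha hb e e0; have e1 : 0 < e / 2 by rewrite divr_gt0.
have [N NP] := ha _ e1; have [M MP] := hb _ e1.
exists (maxn N M) => n; rewrite geq_max => /andP[Nn Mn].
rewrite opprD addrACA; apply: (opb_le _ (opbD (NP n Nn) (MP n Mn))); lra.
Qed.

Lemma ncvg_cst a : ncvg (fun=> a) a.
Proof.
by move=> e e0; exists 0%N => n _; rewrite subrr; apply: opb_le opb0; exact: ltW.
Qed.

Lemma ncvgMl Z a b : ncvg Z a -> ncvg (fun n => b * Z n) (b * a).
Proof.
move=> ha e e0; have [C C0 CP] := op_bounded b.
have C1 : 0 < C + 1 by lra.
have [N NP] := ha _ (divr_gt0 e0 C1).
exists N => n /NP h; rewrite -mulrBr.
have := opbM C0 CP h; apply: opb_le.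
by rewrite mulrCA -[leRHS]mulr1 ler_wpM2l ?ltW // ltr_pdivrMr //; lra.
Qed.

Lemma ncvg_star Z a : ncvg Z a -> ncvg (fun n => star (Z n)) (star a).
Proof.
move=> ha e e0; have [N NP] := ha _ e0; exists N => n /NP h.
by rewrite -starB; apply: opb_star h; exact: ltW.
Qed.

Lemma ncvgMr Z a b : ncvg Z a -> ncvg (fun n => Z n * b) (a * b).
Proof.
move=> /ncvg_star/(ncvgMl (star b))/ncvg_star.
by rewrite starM !starK; congr (ncvg _ _); apply/funext => n; rewrite starM !starK.
Qed.

Lemma ncvgM Z Z' a b C : 0 <= C -> (forall n, opb (Z n) C) ->
  ncvg Z a -> ncvg Z' b -> ncvg (fun n => Z n * Z' n) (a * b).
Proof.
move=> C0 CP ha hb e e0.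
have C1 : 0 < 2 * (C + 1) by lra.
have [N NP] := hb _ (divr_gt0 e0 C1).
have e2 : 0 < e / 2 by rewrite divr_gt0.
have [M MP] := ncvgMr b ha e2.
exists (maxn N M) => n; rewrite geq_max => /andP[Nn Mn].
rewrite -[Z n * Z' n](subrK (Z n * b)) -mulrBr -addrA.
have h1 := opbM C0 (CP n) (NP n Nn).
apply: opb_le (opbD h1 (MP n Mn)).
have -> : C * (e / (2 * (C + 1))) = e / 2 * (C / (C + 1)) by field; lra.
have : C / (C + 1) <= 1 by rewrite ler_pdivrMr ?mul1r; lra.
nra.
Qed.

Lemma ncvgZ Z a t : ncvg Z a -> ncvg (fun n => t%:C *: Z n) (t%:C *: a).
Proof.
move=> /(ncvgMl (t%:C *: (1 : A))).
have h b : (t%:C *: (1 : A)) * b = t%:C *: b by exact: op_ext.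
by rewrite h; congr (ncvg _ _); apply/funext => n.
Qed.

Lemma ncvg_shift Z a : ncvg Z a -> ncvg (fun n => Z n.+1) a.
Proof.
by move=> ha e /ha [N NP]; exists N => n Nn; apply: NP; exact: leqW.
Qed.

Lemma ncvg_opb Z a C : (forall n, opb (Z n) C) -> ncvg Z a -> opb a C.
Proof.
move=> CP ha x; apply/ler_addgt0Pr => e e0.
have x1 : 0 < rn x + 1 by have := rnorm_ge0 rd x; lra.
have [N NP] := ha _ (divr_gt0 e0 x1).
have := NP N (leqnn _) x; rewrite subopE => h.
rewrite -[val a x](subrK (val (Z N) x)) addrC.
apply: le_trans (rnormD rdH _ _) _; rewrite lerD //; first exact: CP.
rewrite (rnormB rdH); apply: le_trans h _.
by rewrite mulrAC ler_pdivrMr // ler_wpM2l ?ltW //; have := rnorm_ge0 rd x; lra.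
Qed.

(** Completeness of [A] in norm: the pointwise limit is bounded and commutes with the commutant. *)
Lemma ncvg_exists Z :
  (forall e, 0 < e -> exists N, forall m n, (N <= m)%N -> (N <= n)%N ->
     opb (Z m - Z n) e) -> exists a, ncvg Z a.
Proof.
move=> Zc.
pose tends (u : nat -> H) l := forall e, 0 < e ->
  exists N, forall n, (N <= n)%N -> rn (u n - l) <= e.
have tuniq u l l' : tends u l -> tends u l' -> l = l'.
  move=> hl hl'; apply/eqP; rewrite -subr_eq0; apply/eqP/(rnorm_eq0 rdH)/eqP.
  rewrite eq_le rnorm_ge0 andbT; apply/ler_addgt0Pr => e e0; rewrite add0r.
  have e1 : 0 < e / 2 by rewrite divr_gt0.
  have [N NP] := hl _ e1; have [M MP] := hl' _ e1.
  have := NP _ (leq_maxl N M); have := MP _ (leq_maxr N M).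
  set k := maxn N M => h1 h2.
  apply: le_trans (rnorm_dist_triangle rdH _ (u k) _) _.
  rewrite (rnormB rdH l); move: h1 h2; set p := rn _; set q := rn _; lra.
have ex x : exists l, tends (fun n => val (Z n) x) l.
  have x1 : 0 < rn x + 1 by have := rnorm_ge0 rd x; lra.
  have [|l hl] := rd_complete rdH (u := fun n => val (Z n) x).
    move=> e e0.
    have s0 : 0 < Num.sqrt e by rewrite sqrtr_gt0.
    have [N NP] := Zc _ (divr_gt0 s0 x1); exists N => m n Nm Nn.
    have := NP m n Nm Nn x; rewrite subopE => h.
    have <- : Num.sqrt e ^+ 2 = e by rewrite sqr_sqrtr // ltW.
    rewrite -(rnorm_sqr rdH) ler_pXn2r ?nnegrE ?rnorm_ge0 ?sqrtr_ge0 //.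
    apply: le_trans h _; rewrite mulrAC ler_pdivrMr // ler_wpM2l ?sqrtr_ge0 //.
    by have := rnorm_ge0 rd x; lra.
  exists l => e e0; have [N NP] := hl (e ^+ 2) ltac:(by rewrite exprn_gt0).
  exists N => n /NP h; rewrite -(@ler_pXn2r _ 2) ?nnegrE ?rnorm_ge0 ?(ltW e0) //.
  by rewrite (rnorm_sqr rdH).
pose T x := projT1 (cid (ex x)).
have TP x : tends (fun n => val (Z n) x) (T x) := projT2 (cid (ex x)).
(* At a fixed x, let the second index of the Cauchy bound tend to infinity; N does not depend on
   x. *)
have unif e : 0 < e -> exists N, forall n, (N <= n)%N ->
    forall x, rn (val (Z n) x - T x) <= e * rn x.
  move=> /Zc [N NP]; exists N => n Nn x; apply/ler_addgt0Pr => d d0.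
  have [M MP] := TP x _ d0.
  have h1 := MP _ (leq_maxr N M); have := NP n (maxn N M) Nn (leq_maxl N M) x.
  rewrite subopE => h2.
  apply: le_trans (rnorm_dist_triangle rdH _ (val (Z (maxn N M)) x) _) _.
  exact: lerD.
have tU (U : H -> H) (C : R) u l : 0 <= C -> (forall x y, U (x - y) = U x - U y) ->
    (forall x, rn (U x) <= C * rn x) -> tends u l -> tends (U \o u) (U l).
  move=> C0 UB CU ul e e0; have C1 : 0 < C + 1 by lra.
  have [N NP] := ul _ (divr_gt0 e0 C1); exists N => n /NP h.
  rewrite /= -UB; apply: le_trans (CU _) _.
  move: h; rewrite ler_pdivlMr //; have := rnorm_ge0 rd (u n - l); nra.
have tD u v l k : tends u l -> tends v k -> tends (fun n => u n + v n) (l + k).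
  move=> hu hv e e0; have e1 : 0 < e / 2 by rewrite divr_gt0.
  have [N NP] := hu _ e1; have [M MP] := hv _ e1.
  exists (maxn N M) => n; rewrite geq_max => /andP[Nn Mn].
  rewrite opprD addrACA; apply: le_trans (rnormD rdH _ _) _.
  rewrite [leRHS](_ : e = e / 2 + e / 2); last by field.
  by rewrite lerD ?NP ?MP.
have tZ (t : R[i]) u l : tends u l -> tends (fun n => t *: u n) (t *: l).
  have tv : val (t *: (1 : A)) = (fun x => t *: x) by [].
  have [C C0] := op_bounded (t *: (1 : A)); rewrite tv => CP.
  by apply: (tU _ C) => // x y; rewrite scalerBr.
have lT : linear T.
  move=> t x y; apply: (tuniq (fun n => val (Z n) (t *: x + y))); first exact: TP.
  have := tD _ _ _ _ (tZ t _ _ (TP x)) (TP y).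
  by congr (tends _ _); apply/funext => n; rewrite op_linear.
have [N0 /(_ N0 (leqnn _)) h0] := unif 1 ltac:(by []).
have [C C0 CP] := op_bounded (Z N0).
have TC x : rn (T x) <= (C + 1) * rn x.
  rewrite -[T x](subrK (val (Z N0) x)) addrC mulrDl.
  apply: le_trans (rnormD rdH _ _) _; rewrite lerD //.
  by rewrite (rnormB rdH).
have [a aT] : exists a : A, val a = T.
  apply: (op_of_commuting lT (C := C + 1)) => //; first lra.
  move=> U AU x; have [D D0 DP] := commutant_hnorm AU.
  have lU : linear U by exact: commutant_linear AU.
  apply: (tuniq (fun n => val (Z n) (U x))); first exact: TP.
  have := tU U D _ _ D0 _ DP (TP x).
  rewrite (_ : U \o _ = fun n => val (Z n) (U x)); last first.
    by apply/funext => n; rewrite /= (commutant_comm _ _ AU).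
  apply=> y z; have := lU (-1) z y.
  by rewrite !scaleN1r (addrC (- z)) (addrC (- U z)).
by exists a => e /unif [N NP]; exists N => n /NP h x; rewrite subopE aT.
Qed.

(** Telescoping the increments against a bounded monotone real sequence gives the Cauchy property.
    Both iterations below, for the absolute value and for the inverse, have this form. *)
Lemma ncvg_dominated Z (z : nat -> R) (C : R) :
  (forall n, opb (Z n.+1 - Z n) (z n.+1 - z n)) ->
  (forall n, z n <= z n.+1) -> (forall n, z n <= C) -> exists a, ncvg Z a.
Proof.
move=> Zz zi zC.
have zm m n : (m <= n)%N -> z m <= z n.
  by move=> /subnK <-; elim: (n - m)%N => // k IH; apply: le_trans IH _; exact: zi.
have Zm m n : (m <= n)%N -> opb (Z n - Z m) (z n - z m).
  move=> /subnK <-; elim: (n - m)%N => [|k IH]; first by rewrite !subrr; exact: opb0.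
  rewrite addSn -(subrKA (Z (k + m)%N)) -[z _.+1 - _](subrKA (z (k + m)%N)).
  exact: opbD.
apply: ncvg_exists => e e0.
pose D := range z; have Ds : has_sup D.
  by split; [exists (z 0%N), 0%N | exists C => _ [n _ <-]].
have [_ [N _ <-] hN] := sup_adherent e0 Ds.
have zl n : z n <= sup D by apply: sup_upper_bound => //; exists n.
have close m n : (N <= m)%N -> (m <= n)%N -> opb (Z n - Z m) e.
  move=> Nm mn; apply: opb_le (Zm _ _ mn).
  have := zm _ _ Nm; have := zl n; move: hN; set S := sup _; lra.
exists N => m n Nm Nn; case/orP: (leq_total m n) => h; last exact: close.
by rewrite -opprB; apply: opbN; exact: close.
Qed.

End NormBounds.

(** * Absolute values, inverses and spectral cuts *)

Section SpectralProjection.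
Variables (R : realType) (H : hilbertType R) (A : vnAlgebra H).
Implicit Types (a b c : A) (x y z : H) (s t : R).
Local Notation rd := (@hre R H).
Local Notation rn := (rnorm (@hre R H)).
Let rdH := hre_hilbert H.

Lemma mulZl (t : R[i]) a b : (t *: a) * b = t *: (a * b).
Proof. exact: op_ext. Qed.

Lemma mulZr (t : R[i]) a b : a * (t *: b) = t *: (a * b).
Proof. by apply: op_ext => x; rewrite mulopE !scaleopE opZ. Qed.

(* Riesz-Nagy: [1 - |a|] is the limit of y_(n+1) = (1 - a^2 + y_n^2) / 2, whose
   increments are dominated by those of the same scalar iteration at a = 0. *)
Lemma abs_exists a : star a = a -> opb a 1 ->
  exists b, [/\ vn_pos b, b * b = a * a & a * b = b * a].
Proof.
move=> sa a1.
pose X := 1 - a * a.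
have sX : star X = X by rewrite starB star1 starM sa.
(* |X x|^2 = |x|^2 - 2 |a x|^2 + |a^2 x|^2, and the last term is at most |a x|^2. *)
have X1 : opb X 1.
  move=> x; rewrite mul1r -(@ler_pXn2r _ 2) ?nnegrE ?rnorm_ge0 // !(rnorm_sqr rdH).
  rewrite subopE oneopE mulopE !(rdDl rdH) !(rdNl rdH) !(rdDr rdH) !(rdNr rdH).
  have e : rd (val a (val a x)) x = rd (val a x) (val a x) by rewrite star_rd sa.
  rewrite [rd x (val a (val a x))](rdC rdH) e.
  have h : rd (val a (val a x)) (val a (val a x)) <= rd (val a x) (val a x).
    rewrite -!(rnorm_sqr rdH) ler_pXn2r ?nnegrE ?rnorm_ge0 //.
    by have := a1 (val a x); rewrite mul1r.
  have := rd_ge0 rdH (val a x); lra.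
pose Y := fix Y n : A := if n is k.+1 then (2^-1 : R)%:C *: (X + Y k * Y k) else 0.
pose y := fix y n : R := if n is k.+1 then 2^-1 * (1 + y k * y k) else 0.
have y01 n : 0 <= y n <= 1 by elim: n => [|n /andP[h1 h2]] /=; nra.
have y0 n : 0 <= y n by case/andP: (y01 n).
have yi n : y n <= y n.+1 by have := y01 n => /andP[h1 h2] /=; nra.
have Yy n : opb (Y n) (y n).
  elim: n => [|n IH] /=; first exact: opb0.
  by apply: opbZ => //; apply: opbD => //; exact: opbM.
have YYy n : opb (Y n.+1 - Y n) (y n.+1 - y n).
  elim: n => [|n IH].
    rewrite /= !subr0 !mulr0 !addr0; exact: opbZ.
  (* u^2 - v^2 = u (u - v) + (u - v) v, a factorisation valid without commutation. *)
  have -> : Y n.+2 - Y n.+1 = (2^-1 : R)%:C *: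
      (Y n.+1 * (Y n.+1 - Y n) + (Y n.+1 - Y n) * Y n).
    rewrite mulrBr mulrBl subrKA -[Y n.+2]/(_ *: (X + Y n.+1 * Y n.+1)).
    rewrite -[X in _ - X = _]/(_ *: (X + Y n * Y n)) -scalerBr opprD addrACA.
    by rewrite subrr add0r.
  have -> : y n.+2 - y n.+1 = 2^-1 * (y n.+1 * (y n.+1 - y n) + (y n.+1 - y n) * y n).
    rewrite -[y n.+2]/(2^-1 * (1 + y n.+1 * y n.+1)).
    by rewrite -[X in _ - X = _]/(2^-1 * (1 + y n * y n)); ring.
  apply: opbZ => //; apply: opbD; apply: opbM => //.
  by rewrite subr_ge0.
have [Yl Yc] : exists Yl, ncvg Y Yl.
  by apply: (ncvg_dominated YYy yi (C := 1)) => n; case/andP: (y01 n).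
have Y1 n : opb (Y n) 1 by apply: opb_le (Yy n); case/andP: (y01 n).
have Yl1 : opb Yl 1 by apply: ncvg_opb Yc.
have YlE : Yl = (2^-1 : R)%:C *: (X + Yl * Yl).
  apply: (ncvg_unique (ncvg_shift Yc)).
  exact: ncvgZ (ncvgD (ncvg_cst X) (ncvgM ler01 Y1 Yc Yc)).
have sYn n : star (Y n) = Y n.
  elim: n => [|n IH] /=; first exact: star0.
  by rewrite starZ starD sX starM IH.
have sY : star Yl = Yl.
  apply: (ncvg_unique (ncvg_star Yc)); move: Yc; congr (ncvg _ _).
  by apply/funext => n; rewrite sYn.
have aYn n : a * Y n = Y n * a.
  elim: n => [|n IH] /=; first by rewrite mulr0 mul0r.
  rewrite mulZl mulZr mulrDl mulrDr mulrA IH -mulrA IH mulrA; congr (_ *: (_ + _)).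
  by rewrite /X mulrBl mulrBr mul1r mulr1 mulrA.
have aY : a * Yl = Yl * a.
  apply: (ncvg_unique (ncvgMl a Yc)); have := ncvgMr a Yc; congr (ncvg _ _).
  by apply/funext => n; rewrite aYn.
(* The fixed-point equation 2 Y = X + Y^2 amounts to (1 - Y)^2 = 1 - X = a^2. *)
have YlE2 : Yl + Yl = X + Yl * Yl.
  have h : (2 : R)%:C *: Yl = X + Yl * Yl.
    by rewrite {1}YlE scalerA -rmorphM mulfV // scale1r.
  by rewrite -h (_ : (2 : R)%:C = 1 + 1) ?scalerDl ?scale1r // -rmorphD.
exists (1 - Yl); split.
- apply/vn_posP; split=> [|x]; first by rewrite starB star1 sY.
  rewrite subopE (rdDl rdH) (rdNl rdH) subr_ge0 oneopE.
  apply: le_trans (ler_norm _) _; apply: le_trans (rd_CauchySchwarz rdH _ _) _.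
  rewrite -(rnorm_sqr rdH) expr2 ler_wpM2r ?rnorm_ge0 //.
  by have := Yl1 x; rewrite mul1r.
- have -> : a * a = 1 - X by rewrite /X opprB addrC subrK.
  have -> : X = Yl + (Yl - Yl * Yl) by rewrite addrA YlE2 addrK.
  by rewrite mulrBl mul1r mulrBr mulr1 -addrA -opprD.
- by rewrite mulrBl mulrBr mul1r mulr1 aY.
Qed.

(* [1 - t a] is a strict contraction for t = d / K^2; sum its Neumann series. *)
Lemma inverse_exists a (d : R) : star a = a -> 0 < d ->
  (forall x, d * rd x x <= rd (val a x) x) -> exists b, a * b = 1.
Proof.
move=> sa d0 ad.
have [K0 K00 K0P] := op_bounded a.
(* The summands d and 1 ensure K > 0 and d < K, so that t d < 1 below. *)
pose K := K0 + d + 1; have Kp : 0 < K by rewrite /K; lra.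
have KP : opb a K by apply: opb_le K0P; rewrite /K; lra.
pose t := d / K ^+ 2; have tp : 0 < t by rewrite divr_gt0 // exprn_gt0.
pose W := 1 - t%:C *: a.
pose r := Num.sqrt (1 - t * d).
have td : t * d < 1.
  have dK : d < K by rewrite /K; lra.
  rewrite /t mulrAC ltr_pdivrMr ?exprn_gt0 // mul1r -expr2.
  by rewrite ltr_pXn2r ?nnegrE ?ltW.
have td0 : 0 < t * d by rewrite mulr_gt0.
have r0 : 0 <= r by exact: sqrtr_ge0.
have rr : r ^+ 2 = 1 - t * d by rewrite sqr_sqrtr //; lra.
have r1 : r < 1 by nra.
(* Since t^2 K^2 = t d, |W x|^2 <= (1 - 2 t d + t d) |x|^2 = r^2 |x|^2. *)
have WP : opb W r.
  move=> x; rewrite -(@ler_pXn2r _ 2) ?nnegrE ?mulr_ge0 ?rnorm_ge0 //.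
  rewrite exprMn rr !(rnorm_sqr rdH) subopE oneopE scaleopE.
  rewrite !(rdDl rdH) !(rdNl rdH) !(rdDr rdH) !(rdNr rdH) !(rdZl rdH) !(rdZr rdH).
  rewrite [rd x (val a x)](rdC rdH).
  have h : rd (val a x) (val a x) <= K ^+ 2 * rd x x.
    rewrite -!(rnorm_sqr rdH) -exprMn.
    by rewrite ler_pXn2r ?nnegrE ?mulr_ge0 ?rnorm_ge0 ?(ltW Kp) //.
  have h2 := ad x.
  have : t * (t * rd (val a x) (val a x)) <= t * d * rd x x.
    rewrite -mulrA ler_wpM2l ?(ltW tp) //.
    rewrite (_ : d = t * K ^+ 2); last by rewrite /t mulfVK // gt_eqF // exprn_gt0.
    by rewrite -mulrA ler_wpM2l ?(ltW tp).
  have : t * (d * rd x x) <= t * rd (val a x) x by rewrite ler_wpM2l ?(ltW tp).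
  set p := rd (val a x) (val a x); set q := rd (val a x) x; set u := rd x x.
  by lra.
pose Z := fix Z n : A := if n is k.+1 then 1 + W * Z k else 0.
pose z := fix z n : R := if n is k.+1 then 1 + r * z k else 0.
have zd n : 0 <= z n.+1 - z n.
  elim: n => [|n IH]; first by rewrite /= mulr0 addr0 subr0.
  rewrite -[z n.+2]/(1 + r * z n.+1) -[X in _ - X]/(1 + r * z n).
  by rewrite opprD addrACA subrr add0r -mulrBr mulr_ge0.
have zi n : z n <= z n.+1 by rewrite -subr_ge0.
have zb n : z n <= (1 - r)^-1.
  have h : 0 < 1 - r by lra.
  elim: n => [|n IH]; first by rewrite /= invr_ge0 ltW.
  have e : (1 - r)^-1 = 1 + r * (1 - r)^-1 :> R by field; rewrite gt_eqF.
  have := ler_wpM2l r0 IH; rewrite -[z n.+1]/(1 + r * z n).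
  move: e; set q := _^-1; move: (z n) => u; lra.
have sh (V : zmodType) (k u v : V) : k + u - (k + v) = u - v.
  by rewrite opprD addrACA subrr add0r.
have ZP n : opb (Z n.+1 - Z n) (z n.+1 - z n).
  elim: n => [|n IH]; first by rewrite /= !mulr0 !addr0 !subr0; exact: opb1.
  rewrite -[z n.+2]/(1 + r * z n.+1) -[X in opb _ (_ - X)]/(1 + r * z n).
  rewrite -[Z n.+2]/(1 + W * Z n.+1) -[X in opb (_ - X) _]/(1 + W * Z n).
  by rewrite !sh -!mulrBr; exact: opbM.
have [L ZL] := ncvg_dominated ZP zi zb.
have LE : L = 1 + W * L.
  apply: (ncvg_unique (ncvg_shift ZL)).
  exact: ncvgD (ncvg_cst 1) (ncvgMl W ZL).
exists (t%:C *: L); rewrite mulZr -mulZl.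
have : L - W * L = 1 by rewrite {1}LE addrK.
by rewrite /W mulrBl mul1r opprB addrC subrK.
Qed.

(* b is cut at a level l below its numerical range: E is the support of
   T + |T| for T a multiple of b - l, so that b >= l on the range of E. *)
Lemma spectral_projection b : vn_pos b -> b <> 0 -> exists (E c : A) (t : R),
  [/\ is_proj E, E <> 0, b * c = E, 0 < t & vn_le E (t%:C *: b)].
Proof.
move=> pb b0; have /vn_posP[sb bge0] := pb.
have [x0 x0P] : exists x, rd (val b x) x <> 0.
  by apply/existsNP => h; apply: b0; exact: sa_eq0.
have bx0 : 0 < rd (val b x0) x0 by rewrite lt_def bge0 andbT; exact/eqP.
have xx0 : 0 < rd x0 x0.
  rewrite lt_def (rd_ge0 rdH) andbT; apply/eqP => /(rd_eq0 rdH) x00.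
  by apply: x0P; rewrite x00 (rd0r rdH).
(* Half the Rayleigh quotient of b at x0: the form of b - l stays positive there, which will give
   [E <> 0]. *)
pose l := rd (val b x0) x0 / 2 / rd x0 x0.
have l0 : 0 < l by rewrite !divr_gt0.
have [C C0 CP] := op_bounded b.
have Cl : 0 < C + l by lra.
pose t := (C + l)^-1; have t0 : 0 < t by rewrite invr_gt0.
pose T := t%:C *: (b - l%:C *: (1 : A)).
have lsa : star (l%:C *: (1 : A)) = l%:C *: (1 : A) by rewrite starZ star1.
have sT : star T = T by rewrite starZ starB sb lsa.
have T1 : opb T 1.
  rewrite -(mulVf (lt0r_neq0 Cl)); apply: opbZ; first exact: ltW.
  apply: opbD => //; apply: opbN; rewrite -[l in opb _ l]mulr1.
  by apply: opbZ; [exact: ltW | exact: opb1].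
have TE x : val T x = t%:C *: (val b x - l%:C *: x) by [].
have bT : b = (t^-1)%:C *: T + l%:C *: (1 : A).
  by rewrite /T scalerA -rmorphM mulVf ?gt_eqF // scale1r subrK.
clearbody T.
have [B [pB BB TB]] := abs_exists sT T1.
have /vn_posP[sB Bge0] := pB.
have [E [pE PE kerE _]] := joint_support (fun _ : unit => B + T).
have {}PE : (B + T) * E = B + T := PE tt.
have {}kerE x : val (B + T) x = 0 -> val E x = 0 by move=> h; apply: kerE => -[].
(* Here B = |T|. The product being 0, B - T vanishes on the range of [E], where T therefore
   coincides with the positive B. *)
have PN : (B + T) * (B - T) = 0.
  by rewrite mulrDl !mulrBr BB TB addrA subrK subrr.
have EN : E * (B - T) = 0.
  by apply: op_ext => x; rewrite mulopE zeroopE; apply: kerE; rewrite -mulopE PN.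
have NE : (B - T) * E = 0.
  by have := congr1 (@star R H A) EN; rewrite starM star0 starB sB sT pE.2.
have BTE : B * E = T * E by apply/eqP; rewrite -subr_eq0 -mulrBl NE.
(* T commutes with B + T, so it preserves the kernel of B + T and commutes with its support. *)
have ETE : E * T = E * T * E.
  apply/eqP; rewrite -subr_eq0 -[X in X - _]mulr1 -mulrBr -mulrA; apply/eqP.
  apply: op_ext => x; rewrite mulopE zeroopE; apply: kerE.
  rewrite -mulopE mulrA.
  have -> : (B + T) * T = T * (B + T) by rewrite mulrDl mulrDr TB.
  by rewrite -mulrA mulrBr mulr1 PE subrr mulr0.
have ET : E * T = T * E.
  by rewrite ETE; have := congr1 (@star R H A) ETE; rewrite !starM sT pE.2 mulrA => <-.
have Eb : E * b = b * E.
  by rewrite bT mulrDl mulrDr !mulZl !mulZr ET mul1r mulr1.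
have bE x : l * rd (val E x) (val E x) <= rd (val b (val E x)) (val E x).
  rewrite bT addopE !scaleopE oneopE (rdDl rdH) !(rdZl rdH) -[val T _]mulopE -BTE.
  by rewrite lerDr mulr_ge0 // ?invr_ge0; [exact: ltW | exact: Bge0].
have EE x : rd (val E x) x = rd (val E x) (val E x).
  by rewrite is_proj_rd // (rnorm_sqr rdH).
have bEE x : rd (val b (val E x)) x = rd (val b (val E x)) (val E x).
  by rewrite -{1}pE.1 -mulopE mulrA -Eb -mulrA mulopE star_rd pE.2.
(* [D] acts as b on the range of [E] and as 1 on its complement, so its form is at least min(l, 1)
   and it is invertible. *)
exists E; pose D := b * E + (1 - E).
have [k DL] : exists k, D * k = 1.
  apply: (@inverse_exists _ (Num.min l 1)).
  - by rewrite starD starM starB star1 sb pE.2 Eb.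
  - by rewrite lt_min l0 ltr01.
  move=> x; rewrite addopE mulopE subopE oneopE !(rdDl rdH) (rdNl rdH) bEE EE.
  have := bE x; have := rd_ge0 rdH (val E x).
  have : rd (val E x) (val E x) <= rd x x.
    rewrite -!(rnorm_sqr rdH) ler_pXn2r ?nnegrE ?rnorm_ge0 //; exact: is_proj_contr.
  set p := rd (val E x) _; set q := rd x x; set u := rd _ _ => h1 h2 h3.
  have m1 : Num.min l 1 <= 1 by rewrite ge_min lexx orbT.
  have ml : Num.min l 1 <= l by rewrite ge_min lexx.
  by nra.
exists (E * k), l^-1; split=> //.
- move=> E0; have Px : val (B + T) x0 = 0 by rewrite -PE E0 mulr0.
  have : rd (val (B + T) x0) x0 = 0 by rewrite Px (rd0l rdH).
  rewrite addopE (rdDl rdH) TE (rdZl rdH) (rdDl rdH) (rdNl rdH) (rdZl rdH).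
  have -> : l * rd x0 x0 = rd (val b x0) x0 / 2 by rewrite /l divfK // gt_eqF.
  have := Bge0 x0.
  have : 0 < t * (rd (val b x0) x0 - rd (val b x0) x0 / 2) by rewrite mulr_gt0 //; lra.
  by set p := t * _; lra.
- have ED : E * D = b * E.
    by rewrite /D mulrDr mulrBr mulr1 pE.1 subrr addr0 mulrA Eb -mulrA pE.1.
  by rewrite mulrA -ED -mulrA DL mulr1.
- by rewrite invr_gt0.
apply/vn_posP; split=> [|x]; first by rewrite starB starZ sb pE.2.
rewrite subopE scaleopE (rdDl rdH) (rdNl rdH) (rdZl rdH) subr_ge0.
rewrite mulrC ler_pdivlMr // mulrC EE; apply: le_trans (bE x) _.
rewrite -subr_ge0 -bEE.
(* As E commutes with b, b - b E = (1 - E) b (1 - E). *)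
have -> : rd (val b x) x - rd (val b (val E x)) x =
    rd (val b (val (1 - E) x)) (val (1 - E) x).
  have [_ sE'] := is_proj_compl pE.
  have cb : (1 - E) * b = b * (1 - E) by rewrite mulrBl mulrBr mul1r mulr1 Eb.
  rewrite [RHS](rdC rdH) [RHS]star_rd sE' -!mulopE cb -mulrA (is_proj_compl pE).1.
  by rewrite [RHS](rdC rdH) mulrBr mulr1 subopE (rdDl rdH) (rdNl rdH).
exact: bge0.
Qed.

End SpectralProjection.

(** * Dimension *)

Section LinearImage.
Variables (S : pzRingType) (P M : lmodType S) (g : P -> M).
Hypothesis glin : linear g.

Lemma lin0 : g 0 = 0.
Proof. by have := glin (- 1) 0 0; rewrite scaler0 addr0 scaleN1r addNr. Qed.

Lemma linZ a u : g (a *: u) = a *: g u.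
Proof. by have := glin a u 0; rewrite !addr0 lin0 addr0. Qed.

Lemma linD u v : g (u + v) = g u + g v.
Proof. by have := glin 1 u v; rewrite !scale1r. Qed.

Lemma linB u v : g (u - v) = g u - g v.
Proof. by rewrite -[- v]scaleN1r linD linZ scaleN1r. Qed.

Definition lin_image : {pred M} := fun y => `[< exists x, y = g x >].

Fact lin_image_submod_closed : submod_closed lin_image.
Proof.
split=> [|a u v]; rewrite !unfold_in.
  by apply/asboolP; exists 0; rewrite lin0.
move=> /asboolP[u' ->] /asboolP[v' ->]; apply/asboolP.
by exists (a *: u' + v'); rewrite glin.
Qed.

End LinearImage.

(** * The modules p A^n and injective maps out of them *)

Section ProjectionModule.
Variables (R : realType) (H : hilbertType R) (A : vnAlgebra H).
Variables (n : nat) (p : 'M[A]_n).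

(* Hides the inference of the module structure, which is slow. *)
Definition proj_module : rightModType A := submodule (mx_image p).

Implicit Types (u v : proj_module).

Definition pm_val v : 'cV[A]_n := sval v.

Lemma pm_val_inj : injective pm_val.
Proof. exact: val_inj. Qed.

Lemma pm_image w : p *m w \in mx_image p.
Proof. by rewrite unfold_in; apply/asboolP; exists w. Qed.

Definition pm_elt (w : 'cV[A]_n) : proj_module :=
  exist (fun x => x \in mx_image p) (p *m w) (pm_image w).

Lemma pm_valK v : p *m p = p -> p *m pm_val v = pm_val v.
Proof.
move=> pp; case: v => w /= wp.
by move: (wp); rewrite unfold_in => /asboolP[w' ->]; rewrite mulmxA pp.
Qed.

Lemma pm_val0 : pm_val 0 = 0.
Proof. by []. Qed.

Lemma pm_valD u v : pm_val (u + v) = pm_val u + pm_val v.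
Proof. by []. Qed.

Lemma pm_valZ (a : A) v i j :
  pm_val ((a : (vn_sort A)^c) *: v) i j = pm_val v i j * a.
Proof. by rewrite [LHS]mxE. Qed.

End ProjectionModule.

Section Dimension.
Variables (R : realType) (H : hilbertType R) (A : vnAlgebra H).
Variable psi : A -> \bar R.

(** An injective linear map is an isomorphism onto its image; together with [vn_dim_le], this lets
    dimensions be compared through such maps. *)
Lemma vn_dim_ge (M : rightModType A) n (p : 'M[A]_n) (g : proj_module p -> M) :
  is_mxproj p -> (mxtrace_weight psi p < +oo)%E -> linear g -> injective g ->
  (mxtrace_weight psi p <= vn_dim psi M)%E.
Proof.
move=> pp pfin glin ginj.
suff iso : iso_to_submodule (proj_module p) M.
  by apply: ereal_sup_ubound; exists n, p; split.
pose L : submodClosed M := HB.pack (lin_image g)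
  (GRing.isSubmodClosed.Build _ _ (lin_image g) (lin_image_submod_closed glin)).
have gL v : g v \in L by rewrite unfold_in; apply/asboolP; exists v.
pose f v : submodule L := exist _ (g v) (gL v).
have flin : linear f by move=> a u v; apply: val_inj; rewrite /= glin.
pose f' : {linear proj_module p -> submodule L} :=
  HB.pack f (GRing.isLinear.Build _ _ _ _ f flin).
exists L, f'.
have ex (y : submodule L) : exists v, val y = g v.
  by have := valP y; rewrite unfold_in => /asboolP.
exists (fun y => projT1 (cid (ex y))) => [v|y].
  by apply: ginj; rewrite -(projT2 (cid (ex (f v)))).
by apply: val_inj; rewrite /= -(projT2 (cid (ex y))).
Qed.

Lemma vn_dim_le (M : rightModType A) (B : \bar R) :
  (forall n (p : 'M[A]_n) (g : proj_module p -> M), is_mxproj p ->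
     (mxtrace_weight psi p < +oo)%E -> linear g -> injective g ->
     (mxtrace_weight psi p <= B)%E) -> (vn_dim psi M <= B)%E.
Proof.
move=> h; apply: ge_ereal_sup => _ [n [p [pp pfin [L [f fbij]] ->]]].
apply: (h n p (fun v => val (f v))) => //.
  by move=> a u v; rewrite linearP.
by move=> u v /val_inj /(bij_inj fbij).
Qed.

End Dimension.

(** * Weights and diagonal entries of matrix projections *)

Section Weights.
Variables (R : realType) (H : hilbertType R) (A : vnAlgebra H).
Variables (psi : A -> \bar R) (psiT : tracial_weight psi).
Implicit Types (a b c : A).

Lemma weight0 : psi 0 = 0%E.
Proof.
have := tw_scale psiT (lexx 0) (vn_pos0 A).
by rewrite mul0e scaler0.
Qed.

Lemma weight_le a b : vn_pos a -> vn_le a b -> (psi a <= psi b)%E.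
Proof.
move=> pa ab; rewrite -[b](subrK a) (tw_add psiT) //.
by rewrite leeDr // (tw_ge0 psiT).
Qed.

Lemma weight_sum I (r : seq I) (F : I -> A) : (forall i, vn_pos (F i)) ->
  psi (\sum_(i <- r) F i) = (\sum_(i <- r) psi (F i))%E.
Proof.
move=> Fp; elim: r => [|i r IH]; first by rewrite !big_nil weight0.
by rewrite !big_cons (tw_add psiT) ?IH //; exact: vn_pos_sum.
Qed.

(** From p = p* p. The trace becomes a sum of terms [psi (star a * a)], between whose factors a
    projection can be inserted. *)
Lemma mxproj_diag n (p : 'M[A]_n) i : is_mxproj p ->
  p i i = \sum_j star (p j i) * p j i.
Proof.
by move=> [pp ps]; rewrite -{1}pp -{1}ps mxE; apply: eq_bigr => j _; rewrite !mxE.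
Qed.

Lemma mxproj_diag_pos n (p : 'M[A]_n) i : is_mxproj p -> vn_pos (p i i).
Proof.
by move=> /mxproj_diag ->; apply: vn_pos_sum => j _; exact: vn_pos_star.
Qed.

Lemma mxproj_star n (p : 'M[A]_n) i j : is_mxproj p -> star (p j i) = p i j.
Proof. by case=> _ /matrixP/(_ i j); rewrite !mxE. Qed.

(** An empty supremum in [\bar R] is -oo; the projection of size 0 rules it out. *)
Lemma vn_dim_ge0 (M : rightModType A) : (0 <= vn_dim psi M)%E.
Proof.
have pp : is_mxproj (0 : 'M[A]_0) by split; apply/matrixP => -[].
have t0 : mxtrace_weight psi (0 : 'M[A]_0) = 0%E by rewrite /mxtrace_weight big_ord0.
rewrite -t0; apply: (@vn_dim_ge _ _ _ _ _ _ _ (fun=> 0)) => //.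
- by rewrite t0 ltry.
- by move=> a u v; rewrite scaler0 addr0.
by move=> u v _; apply: pm_val_inj; apply/matrixP => -[].
Qed.

Lemma sum_star_eq0 n (u : 'I_n -> A) : \sum_i star (u i) * u i = 0 ->
  forall i, u i = 0.
Proof.
move=> u0 i; apply: star_mul_eq0; apply: sa_eq0; first by rewrite starM starK.
move=> x; apply/eqP; rewrite eq_le; apply/andP; split; last first.
  by have /vn_posP[_] := vn_pos_star (u i).
have : hre (val (\sum_i star (u i) * u i) x) x = 0.
  by rewrite u0 zeroopE (rd0l (hre_hilbert H)).
have e : \sum_i star (u i) * u i =
    star (u i) * u i + \sum_(j < n | j != i) star (u j) * u j by rewrite (bigD1 i).
rewrite e addopE (rdDl (hre_hilbert H)).
have /vn_posP[_ /(_ x)] : vn_pos (\sum_(j < n | j != i) star (u j) * u j).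
  by apply: vn_pos_sum => j _; exact: vn_pos_star.
move=> h1 h2; lra.
Qed.

End Weights.

(** * Part (i): dense submodules *)

Section DensityAndDimension.
Variables (R : realType) (H : hilbertType R) (A : vnAlgebra H).
Variables (psi : A -> \bar R) (psiT : semifinite_tracial psi).
Let psiW := st_tracial psiT.

(** The adjoint turns right annihilation by the [q n] into membership of their common kernel. *)
Lemma increasing_mul0 (q : nat -> A) (a : A) : (forall n, is_proj (q n)) ->
  increases_to_1 q -> (forall n, a * q n = 0) -> a = 0.
Proof.
move=> pq q1 aq; have qker := (increases_to_1P pq q1.1).1 q1.
rewrite -[a]starK; have -> : star a = 0; last exact: star0.
apply: op_ext => x; rewrite zeroopE; apply: qker => n.
by rewrite -mulopE -{1}(pq n).2 -starM aq star0.
Qed.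

(** Normality as a limit rather than a supremum, so that the terms of a trace can be added. *)
Lemma weight_conj_cvg (q : nat -> A) (b : A) : (forall n, is_proj (q n)) ->
  increases_to_1 q ->
  (psi (star b * q n * b) @[n --> \oo] --> psi (star b * b))%classic.
Proof.
move=> pq q1.
have pos n : vn_pos (star b * q n * b).
  have := vn_pos_star (q n * b); rewrite starM (pq n).2 !mulrA.
  by rewrite -(mulrA (star b)) (pq n).1.
have mono m n : (m <= n)%N -> vn_le (star b * q m * b) (star b * q n * b).
  move=> mn; apply: conj_le; apply: proj_sub_le => //.
  by have [] := proj_chain pq q1.1 mn.
have -> : psi (star b * b) = ereal_sup (range (fun n => psi (star b * q n * b))).
  rewrite -(image_comp (fun n => star b * q n * b) psi).
  apply: (st_normal psiT); last exact: conj_increases.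
    by move=> _ [n _ <-].
  split; first by exists (star b * q 0%N * b), 0%N.
  move=> _ _ [m _ <-] [n _ <-].
  exists (star b * q (maxn m n) * b); split; first by exists (maxn m n).
    by apply: mono; rewrite leq_maxl.
  by apply: mono; rewrite leq_maxr.
apply: ereal_nondecreasing_cvgn => m n mn.
exact: weight_le (pos m) (mono _ _ mn).
Qed.

Section Modules.
Variables (N : rightModType A) (M : submodClosed N).
Hypothesis MN : forall x : N, exists p : nat -> A,
  [/\ forall n, is_proj (p n), increases_to_1 p & forall n, ract x (p n) \in M].

Lemma dim_quotmod0 : vn_dim psi (quotmod M) = 0%E.
Proof.
apply/eqP; rewrite eq_le vn_dim_ge0 andbT.
apply: vn_dim_le => n p g pp pfin glin ginj.
suff -> : p = 0.
  by rewrite /mxtrace_weight big1 // => i _; rewrite mxE (weight0 psiW).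
apply/matrixP => j i; rewrite mxE.
pose e := pm_elt p (delta_mx i 0).
have eE : pm_val e = col i p by rewrite colE.
have [x gx] : exists x, g e = pi_quotmod M x.
  by exists (repr (g e : Quotient.quot (submod_zmod M))); rewrite /pi_quotmod reprK.
have [q [pq q1 xq]] := MN x.
apply: (increasing_mul0 pq q1) => k.
have : g ((q k : (vn_sort A)^c) *: e) = g 0.
  rewrite (linZ glin) (lin0 glin) gx.
  rewrite -[_ *: _]/(quot_scale _ _) quot_scale_pi -(raddf0 (pi_quotmod M)).
  by apply/pi_quotmod_eq; rewrite subr0; exact: xq.
move=> /ginj/(congr1 (fun v => pm_val v j 0)).
by rewrite pm_valZ eE pm_val0 !mxE.
Qed.

Lemma dim_submodule_le : (vn_dim psi (submodule M) <= vn_dim psi N)%E.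
Proof.
apply: vn_dim_le => n p g pp pfin glin ginj.
apply: (vn_dim_ge (g := fun v => val (g v))) => // [a u v|u v /val_inj/ginj //].
by rewrite glin.
Qed.

Lemma dim_le_submodule : (vn_dim psi N <= vn_dim psi (submodule M))%E.
Proof.
apply: vn_dim_le => n p g pp pfin glin ginj.
pose e i := pm_elt p (delta_mx i 0).
have eE i : pm_val (e i) = col i p by rewrite colE.
pose q i := projT1 (cid (MN (g (e i)))).
have qP i : [/\ forall k, is_proj (q i k), increases_to_1 (q i) &
    forall k, ract (g (e i)) (q i k) \in M] := projT2 (cid (MN (g (e i)))).
have qq i k : q i k * q i k = q i k by have [/(_ k)[]] := qP i.
have sq i k : star (q i k) = q i k by have [/(_ k)[]] := qP i.
(* The left side is Tr (p Q p) for Q the diagonal matrix of the [q j k]; it tends to Tr p as k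
   grows. *)
suff key k : (\sum_(i < n) \sum_(j < n) psi (star (p j i) * q j k * p j i)%R <=
    vn_dim psi (submodule M))%E.
  rewrite /mxtrace_weight; under eq_bigr => i _.
    rewrite (mxproj_diag i pp) (weight_sum psiW); last by move=> j; exact: vn_pos_star.
    over.
  apply: (@cvge_to_le _ \oo%classic _ _
    (fun k => \sum_(i < n) \sum_(j < n) psi (star (p j i) * q j k * p j i)%R)%E);
    last exact: nearW.
  have pos i j k0 : (0 <= psi (star (p j i) * q j k0 * p j i)%R)%E.
    apply: (tw_ge0 psiW); have := vn_pos_star (q j k0 * p j i).
    by rewrite starM sq !mulrA -(mulrA (star _)) qq.
  apply: cvg_nnesum => [i _|i _]; first by apply: nearW => k0; exact: sume_ge0.
  apply: cvg_nnesum => [j _|j _]; first exact: nearW.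
  by have [h1 h2 _] := qP j; exact: weight_conj_cvg.
(* [T] is Q p, so that T* T = p Q p. *)
pose T : 'M[A]_n := \matrix_(i, j) (q i k * p i j).
have [r [rr Tr rker _]] := mx_support (fun _ : unit => T).
have {}Tr : T *m r = T := Tr tt.
have {}rker v : mxop T v = 0 -> mxop r v = 0 by move=> h; apply: rker => -[].
(* The kernel property of [r] concerns vectors of H^n; evaluating the entries of w at each x of H
   carries it to matrices over [A]. *)
have rkerm m (w : 'M[A]_(n, m)) : T *m w = 0 -> r *m w = 0.
  move=> /matrixP Tw; apply/matrixP => i j; rewrite !mxE; apply: op_ext => x.
  have := congr1 (@^~ i) (rker (fun l => val (w l j) x) _).
  rewrite /mxop valop_sum => -> //; apply/funext => l; rewrite /mxop.
  have := Tw l j; rewrite !mxE => /(congr1 (fun a : A => val a x)).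
  by rewrite valop_sum.
have Tp : T *m p = T.
  apply/matrixP => i j; rewrite !mxE; under eq_bigr do rewrite mxE -mulrA.
  by rewrite -mulr_sumr -[in RHS]pp.1 mxE.
have rp : r *m p = r.
  apply/eqP; rewrite -subr_eq0 -[X in _ - X]mulmx1 -mulmxBr; apply/eqP.
  by apply: rkerm; rewrite mulmxBr mulmx1 Tp subrr.
have starmxM (P Q : 'M[A]_n) : mxstar (P *m Q) = mxstar Q *m mxstar P.
  apply/matrixP => i j; rewrite !mxE star_sum; apply: eq_bigr => l _.
  by rewrite starM !mxE.
have pr : p *m r = r.
  by have := congr1 (@mxstar R H A n) rp; rewrite starmxM /mxstar pp.2 rr.2.
(* T = T r = Q p r = Q r. *)
have Tqr i j : T i j = q i k * r i j.
  rewrite -Tr mxE -[in RHS]pr [in RHS]mxE mulr_sumr.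
  by apply: eq_bigr => l _; rewrite mxE mulrA.
have rfin : (mxtrace_weight psi r < +oo)%E.
  apply: le_lt_trans pfin; apply: lee_sum => i _.
  apply: weight_le => //; first exact: mxproj_diag_pos.
  have prp : is_mxproj (p - r).
    split; first by rewrite mulmxBl !mulmxBr pp.1 pr rp rr.1 subrr subr0.
    apply/matrixP => l m.
    by rewrite !mxE starB (mxproj_star _ _ pp) (mxproj_star _ _ rr).
  by have := mxproj_diag_pos i prp; rewrite !mxE.
apply: (@le_trans _ _ (mxtrace_weight psi r)).
  apply: lee_sum => i _; rewrite -(weight_sum psiW); last first.
    move=> j; have := vn_pos_star (q j k * p j i).
    by rewrite starM sq !mulrA -(mulrA (star _)) qq.
  apply: (weight_le psiW).
    apply: vn_pos_sum => j _; have := vn_pos_star (q j k * p j i).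
    by rewrite starM sq !mulrA -(mulrA (star _)) qq.
  rewrite /vn_le (mxproj_diag i rr) -sumrB; apply: vn_pos_sum => j _.
  (* Both sides are [star (T j i) * T j i], by [Tqr]; what remains is the diagonal of r (1 - Q)
     r. *)
  have -> : star (p j i) * q j k * p j i = star (r j i) * q j k * r j i.
    have TT a : star (q j k * a) * (q j k * a) = star a * q j k * a.
      by rewrite starM sq !mulrA -(mulrA (star a)) qq.
    by have := Tqr j i; rewrite /T mxE -!TT => ->.
  rewrite -[X in X * r j i - _]mulr1; apply: conj_le.
  have [pq [_ [ub _]] _] := qP j; apply: ub; by exists k.
pose D : 'M[A]_n := diag_mx (\row_i q i k).
have DT : D *m T = T.
  apply/matrixP => i j; rewrite mul_diag_mx !mxE mulrA qq //.
pose h (v : proj_module r) := pm_elt p (T *m pm_val v).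
(* As T = Q T, h v is a combination of the e_i q_i, which g maps into [M]. *)
have hE v : h v = \sum_i ((T *m pm_val v) i 0 : (vn_sort A)^c) *:
    ((q i k : (vn_sort A)^c) *: e i).
  apply: pm_val_inj; rewrite /= -{1}DT -mulmxA; move: (T *m _) => y.
  rewrite (big_morph (@pm_val _ _ _ _ p) (@pm_valD _ _ _ _ p) (@pm_val0 _ _ _ _ p)).
  apply/matrixP => i j; rewrite (ord1 j) summxE mxE; apply: eq_bigr => l _.
  by rewrite !pm_valZ eE mul_diag_mx !mxE mulrA.
have hlin : linear h.
  have hv v : pm_val (h v) = (p *m T) *m pm_val v by rewrite -mulmxA.
  move=> a u v; apply: pm_val_inj; apply/matrixP => i j.
  rewrite pm_valD [RHS]mxE pm_valZ !hv; move: (p *m T) => P.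
  have mE (w : 'cV[A]_n) : (P *m w) i j = \sum_l P i l * w l j by rewrite mxE.
  rewrite !mE mulr_suml -big_split; apply: eq_bigr => l _.
  by rewrite pm_valD [X in _ * X]mxE pm_valZ mulrDr mulrA.
have gh v : g (h v) \in M.
  rewrite hE (big_morph g (linD glin) (lin0 glin)); apply: rpred_sum => i _.
  rewrite !(linZ glin); apply: rpredZ.
  by have [_ _ qM] := qP i; exact: qM.
pose gM (v : proj_module r) : submodule M := exist _ (g (h v)) (gh v).
apply: (vn_dim_ge (g := gM)) => //.
  by move=> a u v; apply: val_inj; rewrite /= hlin glin.
move=> u v /(congr1 val)/= /ginj huv.
apply/eqP; rewrite -subr_eq0; apply/eqP.
have hw : h (u - v) = 0 by rewrite (linB hlin) huv subrr.
move: (u - v) hw => w hw; apply: pm_val_inj; rewrite pm_val0.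
(* With y = T w, so that Q y = y and p y = 0: y* y = w* p Q y = w* p y = 0. *)
have Tw : T *m pm_val w = 0.
  have : p *m (T *m pm_val w) = 0 by exact: (congr1 (@pm_val _ _ _ _ p) hw).
  have [y yE] : exists y, y = T *m pm_val w by eexists.
  rewrite -yE => pTw.
  have s0 : \sum_i star (y i 0) * y i 0 = 0.
    have yw i : star (y i 0) = \sum_j star (pm_val w j 0) * (p j i * q i k).
      rewrite yE mxE star_sum; apply: eq_bigr => j _.
      by rewrite mxE !starM sq (mxproj_star _ _ pp).
    have qy i : q i k * y i 0 = y i 0.
      by rewrite yE -{2}DT -mulmxA mul_diag_mx !mxE.
    transitivity (\sum_i \sum_j star (pm_val w j 0) * (p j i * y i 0)).
      apply: eq_bigr => i _; rewrite yw mulr_suml; apply: eq_bigr => j _.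
      by rewrite -!mulrA qy.
    rewrite exchange_big big1 // => j _; rewrite -mulr_sumr.
    by have /matrixP/(_ j 0) := pTw; rewrite !mxE => ->; rewrite mulr0.
  apply/matrixP => i j; rewrite (ord1 j) [RHS]mxE.
  exact: (sum_star_eq0 s0).
(* w = r w, and r kills whatever T kills. *)
by rewrite -(pm_valK w rr.1); exact: rkerm.
Qed.

End Modules.
End DensityAndDimension.

(** * Part (ii): elements of modules of dimension zero *)

Section Torsion.
Variables (R : realType) (H : hilbertType R) (A : vnAlgebra H).
Variables (psi : A -> \bar R) (psiT : semifinite_tracial psi).
Variables (M : rightModType A) (x : M).
Let psiW := st_tracial psiT.

Lemma ractM a b : ract x (a * b) = ract (ract x a) b.
Proof. by rewrite /ract scalerA. Qed.

Lemma ract0 : ract x 0 = 0.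
Proof. by rewrite /ract scale0r. Qed.

Lemma ractD a b : ract x (a + b) = ract x a + ract x b.
Proof. by rewrite /ract scalerDl. Qed.

Lemma ract0l (b : A) : ract (0 : M) b = 0.
Proof. by rewrite /ract scaler0. Qed.

(** Semi-finiteness gives b <= e of finite weight; a spectral projection q of b satisfies q <= t b,
    so it has finite weight and vanishes where e does. *)
Lemma finite_subprojection (e : A) : is_proj e -> e <> 0 ->
  exists q : A, [/\ is_proj q, q <> 0, e * q = q & (psi q < +oo)%E].
Proof.
move=> pe e0.
have [b [pb b0 be bfin]] := st_semifinite psiT (is_proj_pos pe) e0.
have [q [c [t [pq q0 bc t0 qb]]]] := spectral_projection pb b0.
exists q; split=> //; last first.
  apply: le_lt_trans (weight_le psiW (is_proj_pos pq) qb) _.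
  by rewrite (tw_scale psiW) ?ltW // lte_mul_pinfty ?lee_fin ?ltW.
have qe : q * (1 - e) = 0.
  apply: op_ext => y; rewrite zeroopE mulopE; apply: (rnorm_eq0 (hre_hilbert H)).
  have := vn_leP qb (val (1 - e) y); rewrite is_proj_rd // scaleopE.
  rewrite (rdZl (hre_hilbert H)).
  have := vn_leP be (val (1 - e) y).
  have -> : val e (val (1 - e) y) = 0.
    by rewrite -mulopE mulrBr mulr1 pe.1 subrr.
  rewrite (rd0l (hre_hilbert H)) => h1 h2.
  apply/eqP; rewrite -sqrf_eq0 eq_le sqr_ge0 andbT; apply: le_trans h2 _.
  by rewrite pmulr_rle0.
have qe2 : q * e = q.
  by apply/eqP; rewrite eq_sym -subr_eq0 -[X in X - _]mulr1 -mulrBr qe.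
by have := congr1 (@star R H A) qe2; rewrite starM pq.2 pe.2.
Qed.

Hypothesis dimM : vn_dim psi M = 0%E.

Lemma annihilating_subprojection (e : A) : is_proj e -> e <> 0 ->
  exists q : A, [/\ is_proj q, q <> 0, e * q = q & ract x q = 0].
Proof.
move=> pe e0.
have [f [pf f0 ef ffin]] := finite_subprojection pe e0.
suff [a [a0 fa xa]] : exists a : A, [/\ a <> 0, f * a = a & ract x a = 0].
  (* q = a (a* c) is killed by x and fixed by f on the left because a is; this is why [a * star a]
     is used and not [star a * a]. *)
  have [||q [c [t [pq q0 aq _ _]]]] := @spectral_projection _ _ _ (a * star a).
  - by rewrite -{1}[a]starK; exact: vn_pos_star.
  - move=> aa; apply: a0; rewrite -[a]starK (_ : star a = 0) ?star0 //.
    by apply: star_mul_eq0; rewrite starK.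
  exists q; split=> //; last by rewrite -aq -mulrA ractM xa ract0l.
  have fq : f * q = q by rewrite -aq !mulrA fa.
  by rewrite -fq mulrA ef.
pose P : 'M[A]_1 := const_mx f.
have PP : is_mxproj P.
  split; apply/matrixP => i j; rewrite !mxE; last exact: pf.2.
  by rewrite big_ord1 !mxE pf.1.
have PE : mxtrace_weight psi P = psi f by rewrite /mxtrace_weight big_ord1 mxE.
pose g (v : proj_module P) : M := ract x (pm_val v ord0 ord0).
have glin : linear g.
  by move=> a u v; rewrite /g pm_valD mxE pm_valZ ractD ractM.
(* If this map were injective, psi f would be at most dim M = 0, against faithfulness. *)
have [ginj|] := pselect (injective g).
  have := vn_dim_ge PP (_ : (mxtrace_weight psi P < +oo)%E) glin ginj.
  rewrite PE dimM => /(_ ffin) h; exfalso; apply: f0.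
  apply: (st_faithful psiT) (is_proj_pos pf) _.
  by apply/eqP; rewrite eq_le h (tw_ge0 psiW) //; exact: is_proj_pos.
move=> /existsNP[u /existsNP[v /not_implyP[guv uv]]].
pose w := u - v.
have w0 : w <> 0 by move/eqP; rewrite subr_eq0 => /eqP.
exists (pm_val w ord0 ord0); split.
- move=> h; apply: w0; apply: pm_val_inj; apply/matrixP => i j.
  by rewrite (ord1 i) (ord1 j) h pm_val0 mxE.
- by have /matrixP/(_ ord0 ord0) := pm_valK w PP.1; rewrite mxE big_ord1 mxE.
- by rewrite -[LHS]/(g w) (linB glin) guv subrr.
Qed.

Lemma annihilated_by_increasing : sigma_finite_vn A ->
  exists p : nat -> A,
    [/\ forall n, is_proj (p n), increases_to_1 p & forall n, ract x (p n) = 0].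
Proof.
move=> Asf.
pose family (D : set A) :=
  (forall a, D a -> [/\ is_proj a, a <> 0 & ract x a = 0]) /\
  (forall a b, D a -> D b -> a <> b -> a * b = 0).
have [D [[Dproj Dorth] Dmax]] : exists D, family D /\
    forall B, (D `<` B)%classic -> ~ family B.
  apply: Zorn_bigcup => F Ffam Ftot; split=> [a [X FX Xa]|a b [X FX Xa] [Y FY Yb] ab].
    exact: (Ffam X FX).1.
  have [XY|YX] := Ftot X Y FX FY.
    by apply: (Ffam Y FY).2 => //; exact: XY.
  by apply: (Ffam X FX).2 => //; exact: YX.
have /countable_injP[f finj] : countable D.
  by apply: Asf => [a /Dproj[]|].
(* An enumeration of [D]; indices outside the image of f get 0, again a projection killed by x and
   orthogonal to the others. *)
pose d n : A := xget 0 [set a | D a /\ f a = n]%classic.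
have dP n : (D (d n) /\ f (d n) = n) \/ d n = 0.
  by rewrite /d; case: xgetP => [y -> []|]; [left | right].
have Dd a : D a -> d (f a) = a.
  move=> Da; have [h1 h2] := xgetPex (0 : A)
    (ex_intro (fun y => D y /\ f y = f a) a (conj Da erefl)).
  by apply: finj; rewrite ?inE.
have dproj n : is_proj (d n).
  by case: (dP n) => [[/Dproj[]]|->] //; exact: is_proj0.
have xd n : ract x (d n) = 0.
  by case: (dP n) => [[/Dproj[]]|->] //; exact: ract0.
have dorth m n : m <> n -> d m * d n = 0.
  move=> mn; case: (dP m) => [[Dm fm]|->]; last by rewrite mul0r.
  case: (dP n) => [[Dn fn]|->]; last by rewrite mulr0.
  by apply: Dorth => // h; apply: mn; rewrite -fm -fn h.
pose p n := \sum_(k < n) d k.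
have pS n : p n.+1 = p n + d n by rewrite /p big_ord_recr.
have pd m n : (n <= m)%N -> p n * d m = 0.
  move=> nm; rewrite mulr_suml big1 // => k _; apply: dorth => km.
  by have := ltn_ord k; rewrite km ltnNge nm.
have dp m n : (n <= m)%N -> d m * p n = 0.
  move=> nm; rewrite mulr_sumr big1 // => k _; apply: dorth => km.
  by have := ltn_ord k; rewrite -km ltnNge nm.
have pproj n : is_proj (p n).
  elim: n => [|n [IH1 IH2]]; first by rewrite /p big_ord0; exact: is_proj0.
  rewrite pS; split; last by rewrite starD IH2 (dproj n).2.
  by rewrite mulrDl !mulrDr IH1 pd // dp // (dproj n).1 addr0 add0r.
have pinc n : vn_le (p n) (p n.+1).
  by rewrite /vn_le pS addrC addKr; exact: is_proj_pos.
exists p; split=> // [|n]; last first.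
  elim: n => [|n IH]; first by rewrite /p big_ord0 ract0.
  by rewrite pS ractD IH xd addr0.
apply/(increases_to_1P pproj pinc) => y py.
have dy n : val (d n) y = 0.
  by have := py n.+1; rewrite pS addopE py add0r.
have [e [pe de kere _]] := joint_support d.
have [e1|e1] := pselect (1 - e = 0).
  have -> : y = val (1 - e) y + val e y by rewrite subopE subrK.
  by rewrite e1 kere // addr0.
(* [1 - e] is orthogonal to all of [D], so a nonzero projection below it that x kills would enlarge
   the maximal family. *)
have [q [pq q0 eq xq]] := annihilating_subprojection (is_proj_compl pe) e1.
have dq a : D a -> a * q = 0.
  move=> Da; rewrite -(Dd a Da) -eq mulrA mulrBr mulr1 de subrr mul0r //.
have qd a : D a -> q * a = 0.
  move=> Da; have := congr1 (@star R H A) (dq a Da).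
  by have [pa _ _] := Dproj a Da; rewrite starM pa.2 pq.2 star0.
exfalso; apply: (Dmax (D `|` [set q])%classic).
  split=> [a Da|]; first by left.
  (* The enlargement is strict: q in [D] would give q = q q = 0. *)
  by move=> /(_ q (or_intror erefl)) /dq; rewrite pq.1.
split=> [a [/Dproj //|->]|a b [Da|->] [Db|->] ab] //.
- exact: Dorth.
- exact: dq.
- exact: qd.
Qed.

End Torsion.

Theorem lemmaB27 (R : realType) (H : hilbertType R) (A : vnAlgebra H)
    (psi : A -> \bar R) (psi_trace : semifinite_tracial psi)
    (A_sigma_finite : sigma_finite_vn A) :
  (forall (N : rightModType A) (M : submodClosed N),
    (forall x : N, exists p : nat -> A,
      [/\ forall n, is_proj (p n),
          increases_to_1 p &
          forall n, ract x (p n) \in M]) ->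
    vn_dim psi (quotmod M) = 0%E /\
    vn_dim psi (submodule M) = vn_dim psi N) /\
  (forall M : rightModType A,
    vn_dim psi M = 0%E ->
    forall x : M, exists p : nat -> A,
      [/\ forall n, is_proj (p n),
          increases_to_1 p &
          forall n, ract x (p n) = 0]).
Proof.
split=> [N M MN|M dimM x]; last exact: (annihilated_by_increasing psi_trace).
split; first exact: dim_quotmod0.
apply/eqP; rewrite eq_le dim_submodule_le //=.
exact: dim_le_submodule.
Qed.
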